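(* Let $(T_t)_{t\geq 0}$ be a $C_0$-semigroup on a separable Banach space $X$. If $(T_t)_{t\ge 0}$ satisfies the Frequent Hypercyclicity Criterion for semigroups, then every operator $T_{t}$, $t>0$, has the operator specification property (OSP) and, therefore, the semigroup $(T_t)_{t\ge 0}$ has the specification property for semigroups (SgSP).
   Context: A $C_0$-semigroup on a Banach space $X$ is a family $(T_t)_{t\ge 0}$ of bounded linear operators on $X$ with $T_0=\mathrm{Id}$, $T_tT_s=T_{t+s}$ for all $t,s\ge 0$, and $\lim_{t\to s}T_tx=T_sx$ for all $x\in X$, $s\ge 0$. Frequent Hypercyclicity Criterion for semigroups (Mangino–Peris): $(T_t)_{t\ge0}$ satisfies it if there exist a dense subset $X_0\subset X$ and maps $S_t:X_0\to X_0$, $t>0$, such that (i) $T_tS_tx=x$ and $T_tS_rx=S_{r-t}x$ for all $x\in X_0$ and $r>t>0$; (ii) $t\mapsto T_tx$ is Pettis integrable on $[0,\infty)$ for all $x\in X_0$; (iii) $t\mapsto S_tx$ is Pettis integrable on $[0,\infty)$ for all $x\in X_0$. (A function $f:[0,\infty)\to X$ is Pettis integrable if $\langle\varphi,f\rangle$ is Lebesgue integrable for every $\varphi\in X'$ and for every measurable $E\subset[0,\infty)$ there is $x_E\in X$ with $\langle\varphi,x_E\rangle=\int_E\langle\varphi,f(t)\rangle\,dt$ for all $\varphi\in X'$.) OSP: A bounded linear operator $T:X\to X$ on a separable Banach space has the OSP if there is an increasing sequence $(K_m)_{m\in\mathbb{N}}$ of $T$-invariant subsets of $X$ with $0\in K_1$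 and $\overline{\bigcup_m K_m}=X$ such that for each $m\in\mathbb{N}$ and each $\delta>0$ there is a positive integer $N_{\delta,m}$ such that for every integer $s\ge 2$, any set $\{y_1,\dots,y_s\}\subset K_m$ and any integers $0=j_1\le k_1<j_2\le k_2<\dots<j_s\le k_s$ with $j_{r+1}-k_r\ge N_{\delta,m}$ for $1\le r\le s-1$, there is $x\in K_m$ such that $\|T^i(x)-T^i(y_r)\|<\delta$ for all $1\le r\le s$ and all integers $i$ with $j_r\le i\le k_r$, and $T^n(x)=x$ for $n=N_{\delta,m}+k_s$. SgSP: A $C_0$-semigroup $(T_t)_{t\ge 0}$ on a separable Banach space $X$ has the SgSP if there exist an increasing sequence $(K_n)_{n\in\mathbb{N}}$ of subsets of $X$ with $0\in K_1$ and $\overline{\bigcup_{n} K_n}=X$, and a $t_0>0$, such that for each $n\in\mathbb{N}$ the set $K_n$ is $T_{t_0}$-invariant (i.e. $T_{t_0}(K_n)\subset K_n$), and for every $\delta>0$ there is $M_{\delta,n}>t_0$ such that for any integer $s\ge 2$, any set $\{y_1,\dots,y_s\}\subset K_n$ and any real numbers $0=a_1\le b_1<a_2\le b_2<\dots<a_s\le b_s$ satisfying $a_{r+1}-b_r\ge M_{\delta,n}$ for $r=1,\dots,s-1$, there is a point $x\in K_n$ such that - $\|T_t(x)-T_t(y_r)\|<\delta$ for each $t\in[a_r,b_r]$, $r=1,\dots,s$; - $T_{t'}(x)=x$, where $t'$ is the (unique) element of $[M_{\delta,n}+b_s,\,M_{\delta,n}+b_s+t_0)\cap \mathbb{N}\cdot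 t_0$, with $\mathbb{N}\cdot t_0=\{kt_0 : k\in\mathbb{N}\}$. *)

(* Defs.v *)
From HB Require Import structures.
From mathcomp Require Import all_boot all_order all_algebra complex.
From mathcomp Require Import all_classical all_reals all_analysis.

Set Implicit Arguments.
Unset Strict Implicit.
Unset Printing Implicit Defensive.

Import Order.TTheory GRing.Theory Num.Theory.
Import numFieldNormedType.Exports.

Local Open Scope classical_set_scope.
Local Open Scope ring_scope.

(* Banach spaces are taken over the real or over the complex numbers. *)
Variant scalar_kind := RealScalars | ComplexScalars.

Definition scalar_field (R : realType) (k : scalar_kind) : numFieldType :=
  match k with
  | RealScalars => R
  | ComplexScalars => R[i]
  end.

Section lebesgue_integral_of_scalar_functions.
Context (R : realType).

(* Integrability and measurability are with respect to the complete Lebesgue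
   sigma-algebra: [lebesgue_measure] itself only lives on the Borel sets. *)
Local Notation mu := (@completed_lebesgue_measure R).

Definition lebesgue_measurable (E : set R) : Prop :=
  (wlength idfun)^*%mu.-cara.-measurable E.

Definition scalar_integrable (k : scalar_kind) (E : set R) :
    (R -> scalar_field R k) -> Prop :=
  match k return (R -> scalar_field R k) -> Prop with
  | RealScalars => fun f => mu.-integrable E (fun t => (f t)%:E)
  | ComplexScalars => fun f =>
      mu.-integrable E (fun t => (complex.Re (f t))%:E) /\
      mu.-integrable E (fun t => (complex.Im (f t))%:E)
  end.

Definition scalar_integral (k : scalar_kind) (E : set R) :
    (R -> scalar_field R k) -> scalar_field R k :=
  match k return (R -> scalar_field R k) -> scalar_field R k with
  | RealScalars => fun f => \int[mu]_(t in E) f t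
  | ComplexScalars => fun f =>
      Complex (\int[mu]_(t in E) complex.Re (f t))
              (\int[mu]_(t in E) complex.Im (f t))
  end.

End lebesgue_integral_of_scalar_functions.

Definition separable_space (T : topologicalType) : Prop :=
  exists2 D : set T, countable D & dense D.

Definition bounded_linear (K : numFieldType) (V W : normedModType K)
    (f : V -> W) : Prop :=
  linear f /\ exists M : K, forall x, `|f x| <= M * `|x|.

Definition pettis_integrable (R : realType) (k : scalar_kind)
    (X : normedModType (scalar_field R k)) (f : R -> X) : Prop :=
  (forall phi : X -> (scalar_field R k)^o, bounded_linear phi ->
     scalar_integrable `[0, +oo[ (fun t => phi (f t))) /\
  (forall E : set R, lebesgue_measurable E -> E `<=` `[0, +oo[ ->
     exists xE : X, forall phi : X -> (scalar_field R k)^o, bounded_linear phi ->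
       phi xE = scalar_integral E (fun t => phi (f t))).

(* Families indexed by t >= 0 are functions on R whose values at t < 0 are
   irrelevant. *)
Definition C0_semigroup (R : realType) (K : numFieldType)
    (X : normedModType K) (T : R -> X -> X) : Prop :=
  [/\ forall t : R, 0 <= t -> bounded_linear (T t),
      forall x, T 0 x = x,
      forall (t s : R) (x : X), 0 <= t -> 0 <= s -> T t (T s x) = T (t + s) x
    & forall (x : X) (s : R), 0 <= s ->
        T t x @[t --> within `[0, +oo[ (nbhs s)] --> T s x].

(* S t is only constrained for t > 0; the value of t |-> S t x at the single
   point t = 0 does not affect its Pettis integrability. *)
Definition frequent_hypercyclicity_criterion (R : realType) (k : scalar_kind)
    (X : normedModType (scalar_field R k)) (T : R -> X -> X) : Prop :=
  exists (X0 : set X) (S : R -> X -> X),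
    [/\ dense X0 /\ (forall (t : R) x, 0 < t -> X0 x -> X0 (S t x)),
        forall (t : R) x, 0 < t -> X0 x -> T t (S t x) = x,
        forall (t r : R) x, 0 < t -> t < r -> X0 x -> T t (S r x) = S (r - t) x,
        forall x, X0 x -> pettis_integrable (fun t => T t x)
      & forall x, X0 x -> pettis_integrable (fun t => S t x)].

(* In the next two definitions, the sequence of sets starts at index 0, the
   points and interval bounds numbered 1, ..., s are given by the values at
   0, ..., s - 1 of functions on nat, and delta ranges over the scalars, in
   which 0 < delta forces delta to be real. *)
Definition OSP (K : numFieldType) (X : normedModType K) (T : X -> X) : Prop :=
  exists A : nat -> set X,
    [/\ forall m, A m `<=` A m.+1,
        forall m, T @` A m `<=` A m,
        A 0%N 0,
        closure (\bigcup_m A m) = setT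
      & forall (m : nat) (delta : K), 0 < delta ->
        exists2 N : nat, (0 < N)%N &
        forall (s : nat) (y : nat -> X) (j k : nat -> nat),
          (2 <= s)%N ->
          (forall r, (r < s)%N -> A m (y r)) ->
          j 0%N = 0%N ->
          (forall r, (r < s)%N -> (j r <= k r)%N) ->
          (forall r, (r.+1 < s)%N ->
             (k r < j r.+1)%N /\ (N <= j r.+1 - k r)%N) ->
          exists2 x : X, A m x &
            (forall r i, (r < s)%N -> (j r <= i <= k r)%N ->
               `|iter i T x - iter i T (y r)| < delta) /\
            iter (N + k s.-1) T x = x].

Definition SgSP (R : realType) (K : numFieldType) (X : normedModType K)
    (T : R -> X -> X) : Prop :=
  exists (A : nat -> set X) (t0 : R),
    [/\ forall n, A n `<=` A n.+1,
        A 0%N 0,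
        closure (\bigcup_n A n) = setT,
        0 < t0
      & forall n : nat, T t0 @` A n `<=` A n /\
        forall delta : K, 0 < delta ->
        exists2 M : R, t0 < M &
        forall (s : nat) (y : nat -> X) (a b : nat -> R),
          (2 <= s)%N ->
          (forall r, (r < s)%N -> A n (y r)) ->
          a 0%N = 0 ->
          (forall r, (r < s)%N -> a r <= b r) ->
          (forall r, (r.+1 < s)%N -> b r < a r.+1 /\ M <= a r.+1 - b r) ->
          exists2 x : X, A n x &
            (forall (r : nat) (t : R), (r < s)%N -> a r <= t <= b r ->
               `|T t x - T t (y r)| < delta) /\
            exists2 l : nat,
              M + b s.-1 <= l%:R * t0 < M + b s.-1 + t0 &
              T (l%:R * t0) x = x].

(* Main.v *)
(* Gluing the orbits [T_s x] (s >= 0) and [S_(-s) x] (s < 0), with x in X0,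
   gives full trajectories g : R -> X of the semigroup, and Pettis integration
   of g over Borel sets is a vector measure nu with [T_t (nu E) = nu (E + t)].
   By the Orlicz-Pettis argument nu vanishes in norm at infinity, uniformly over
   Borel sets, although integrability is only assumed weakly. The vectors
   [nu [0, h[ / h] with x in X0 are dense, so countably many such measures Y_i
   and lengths h_i <= t0 suffice. For a coding al : Z -> {0, ..., m}, the sum over
   i of Y_i evaluated at the union of the [0, h_i[ - n t0 with al n = i is a
   continuous image of the full shift on m + 1 symbols that intertwines the shift
   with T_t0. Taking K_m to be its image, a periodic coding that copies those of
   y_1, ..., y_s on windows around the prescribed intervals provides the point x,
   and it serves for real and for integer times alike. *)

Require Import Defs.
From HB Require Import structures.
From mathcomp Require Import all_boot all_order all_algebra.
From mathcomp Require Import all_classical all_reals all_analysis.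
From mathcomp Require Import complex measurable_realfun.
From mathcomp Require Import ring lra zify.

Set Implicit Arguments.
Unset Strict Implicit.
Unset Printing Implicit Defensive.

Import Order.TTheory GRing.Theory Num.Theory.
Import numFieldNormedType.Exports.

Local Open Scope classical_set_scope.
Local Open Scope ring_scope.

(** * Functionals of norm at most 1 and the Hahn-Banach theorem *)

Definition dual_ball (R : realType) (V : normedModType R) (f : V -> R) : Prop :=
  scalar f /\ forall v, `|f v| <= `|v|.

Lemma measurable_norm_ge (R : realType) (r : R) :
  measurable [set t : R | r <= `|t|].
Proof.
rewrite (_ : [set _ | _] = `]-oo, -r] `|` `[r, +oo[); first exact: measurableU.
apply/seteqP; split=> t /=; rewrite !in_itv/= andbT ler_normr lerNr.
  by move=> /orP[]; [right|left].
by move=> [->|->]; rewrite ?orbT.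
Qed.

Section hahn_banach.
Context (R : realType) (V : normedModType R).

(** Partial functionals are kept as graphs, so that Zorn's lemma applies to inclusion of sets;
    single-valuedness is a consequence of domination by the norm. *)
Let dominated_graph (G : set (V * R)) : Prop :=
  (forall a x y r s, G (x, r) -> G (y, s) -> G (a *: x + y, a * r + s)) /\
  (forall x r, G (x, r) -> r <= `|x|).

Let dominated_graph0 G x r : dominated_graph G -> G (x, r) -> G (0, 0).
Proof.
move=> [Glin _] Gx; have := Glin (-1) _ _ _ _ Gx Gx.
by rewrite scaleN1r mulN1r !addNr.
Qed.

Let dominated_graph_fun G x r s :
  dominated_graph G -> G (x, r) -> G (x, s) -> r = s.
Proof.
move=> GG; have [Glin Gdom] := GG.
have le u w : G (x, u) -> G (x, w) -> w <= u.
  move=> Gu Gw; have := Gdom _ _ (Glin (-1) _ _ _ _ Gu Gw).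
  by rewrite scaleN1r mulN1r addNr normr0 addrC subr_le0.
by move=> Gr Gs; apply/eqP; rewrite eq_le !le.
Qed.

Let dominated_graph_extend G x0 r0 w : dominated_graph G -> G (x0, r0) ->
  exists c, dominated_graph [set z | exists t y s,
    G (y, s) /\ z = (y + t *: w, s + t * c)].
Proof.
move=> GG Gx0; have [Glin Gdom] := GG.
have G0 := dominated_graph0 GG Gx0.
(* A value [c] at [w] is admissible when [r - |x - w| <= c <= |y + w| - s] for all [(x, r)] and
   [(y, s)] in [G]. By the triangle inequality every lower bound is at most every upper bound, so
   the supremum of the lower ones works. *)
pose L := [set l | exists x r, G (x, r) /\ l = r - `|x - w|].
have Lub y s : G (y, s) -> ubound L (`|y + w| - s).
  move=> Gy _ [x [r [Gx ->]]].
  rewrite lerBrDr addrAC lerBlDr.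
  have := Gdom _ _ (Glin 1 _ _ _ _ Gx Gy); rewrite scale1r mul1r => /le_trans; apply.
  have -> : x + y = (y + w) + (x - w) by rewrite addrACA subrr addr0 addrC.
  exact: ler_normD.
have supL : has_sup L.
  split; first by exists (0 - `|0 - w|), 0, 0.
  by exists (`|0 + w| - 0); exact: Lub.
exists (sup L); split.
  move=> a x y r s [t [x1 [r1 [G1 [-> ->]]]]] [u [x2 [r2 [G2 [-> ->]]]]].
  exists (a * t + u), (a *: x1 + x2), (a * r1 + r2); split; first exact: Glin.
  by congr pair; [rewrite scalerDr scalerDl scalerA addrACA|ring].
move=> _ _ [t [y [s [Gy [-> ->]]]]].
have Gz a : G (a *: y, a * s) by have := Glin a _ _ _ _ Gy G0; rewrite !addr0.
(* Dividing by [|t|] reduces the claim to the lower estimate on [c] when [t < 0] and to the upper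
   one when [t > 0]. *)
have [t0|t0|->] := ltrgtP t 0; last by rewrite mul0r scale0r !addr0 Gdom.
- have : L (- t^-1 * s - `|- t^-1 *: y - w|) by exists (- t^-1 *: y), (- t^-1 * s).
  move=> /(ub_le_sup supL.2); rewrite lerBlDr -lerBlDl => h.
  have -> : y + t *: w = (- t) *: (- t^-1 *: y - w).
    by rewrite scalerBr scalerA mulrNN divff ?lt_eqF// scale1r !scaleNr opprK.
  rewrite normrZ gtr0_norm ?oppr_gt0// -ler_pdivrMl ?oppr_gt0//.
  apply: le_trans h; rewrite invrN mulrDr mulNr mulrA mulNr mulVf ?lt_eqF//.
  by rewrite mulN1r.
- have h : sup L <= `|t^-1 *: y + w| - t^-1 * s.
    by apply: ge_sup => //; [exact: supL.1|exact: Lub].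
  have -> : y + t *: w = t *: (t^-1 *: y + w).
    by rewrite scalerDr scalerA divff ?gt_eqF// scale1r.
  rewrite normrZ gtr0_norm// -ler_pdivrMl//.
  move: h; rewrite lerBrDl; apply: le_trans.
  by rewrite mulrDr mulrA mulVf ?gt_eqF// mul1r.
Qed.

(* Hahn-Banach, applied to the norm as the dominating sublinear functional. *)
Lemma norming_functional (v : V) : exists2 f, dual_ball f & f v = `|v|.
Proof.
(* The value at [v] is prescribed on nonempty graphs only, because the empty chain has empty union;
   a maximal graph is nonempty by comparison with the line spanned by [v]. *)
pose P G := dominated_graph G /\ (G !=set0 -> G (v, `|v|)).
have totP F : F `<=` P -> total_on F subset -> P (\bigcup_(G in F) G).
  move=> FP Ftot; split; last first.
    by move=> [z [G FG Gz]]; exists G => //; apply: (FP _ FG).2; exists z.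
  split=> [a x y r s [G FG Gx] [H FH Hy]|x r [G FG]]; last exact: (FP _ FG).1.2.
  have [GH|HG] := Ftot _ _ FG FH.
    by exists H => //; apply: (FP _ FH).1.1 => //; exact: GH.
  by exists G => //; apply: (FP _ FG).1.1 => //; exact: HG.
have [A [[AA Av] Amax]] := Zorn_bigcup totP.
have {}Av : A (v, `|v|).
  apply: Av; apply/set0P/negP => /eqP A0.
  apply: (Amax [set z | exists a, z = (a *: v, a * `|v|)]).
    rewrite A0 properEneq; split=> //.
    by apply/eqP => /seteqP[_ /(_ (v, `|v|))]; apply; exists 1; rewrite scale1r mul1r.
  split; last by move=> _; exists 1; rewrite scale1r mul1r.
  split=> [a x y r s [t [-> ->]] [u [-> ->]]|x r [t [-> ->]]].
    by exists (a * t + u); rewrite scalerDl scalerA mulrDl mulrA.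
  by rewrite normrZ ler_wpM2r// ler_norm.
have A0 := dominated_graph0 AA Av.
have Atot w : exists r, A (w, r).
  apply: contrapT => Aw; have [c Bdom] := dominated_graph_extend w AA Av.
  move: Bdom; set B := (B in dominated_graph B) => Bdom.
  have AB : A `<=` B.
    by move=> [x r] Ax; exists 0, x, r; split=> //; rewrite scale0r mul0r !addr0.
  apply: (Amax B); last by split=> // _; exact: AB.
  split=> // BA; apply: Aw; exists c; apply: BA.
  by exists 1, 0, 0; split=> //; rewrite scale1r mul1r !add0r.
have /choice[f Af] := Atot.
exists f; last exact: dominated_graph_fun AA (Af v) Av.
have flin : scalar f.
  by move=> a x y; apply: (dominated_graph_fun AA (Af _)); apply: AA.1.
split=> // x; rewrite ler_norml AA.2// andbT.
have := AA.1 (-1) _ _ _ _ (Af x) A0; rewrite scaleN1r mulN1r !addr0.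
by move=> /AA.2; rewrite normrN lerNl.
Qed.

End hahn_banach.

(** * Orlicz-Pettis theorem *)

Section orlicz_pettis.
Context (R : realType) (V : normedModType R).

Lemma dual_ballB (f : V -> R) : dual_ball f -> forall u v, f (u - v) = f u - f v.
Proof.
by move=> [flin _] u v; rewrite -[u - v]addrC -scaleN1r flin mulN1r addrC.
Qed.

Lemma dual_ballD (f : V -> R) : dual_ball f -> forall u v, f (u + v) = f u + f v.
Proof. by move=> [flin _] u v; have := flin 1 u v; rewrite scale1r mul1r. Qed.

Lemma dual_ball_sep (u v : V) :
  (forall f, dual_ball f -> f u = f v) -> u = v.
Proof.
move=> uv; have [f bf fE] := norming_functional (u - v).
apply/subr0_eq/normr0_eq0; rewrite -fE dual_ballB// uv//.
exact: subrr.
Qed.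

(** Sequential weak* compactness of the dual ball of a separable space. [L] is the pointwise limit
    along an ultrafilter finer than [eventually]; [psi (s n)] is then chosen within [1 / (n + 1)] of
    [L] at [d 0], ..., [d n], and the norm bound 1 extends convergence from the dense sequence to
    all vectors. *)
Lemma dual_ball_subsequence (d : nat -> V) (psi : nat -> V -> R) :
  (forall v (e : R), 0 < e -> exists n, `|v - d n| < e) ->
  (forall n, dual_ball (psi n)) ->
  exists2 L : V -> R, dual_ball L & exists s : nat -> nat,
    (forall n, (n <= s n)%N) /\
    forall v (e : R), 0 < e ->
      exists N, forall n, (N <= n)%N -> `|psi (s n) v - L v| < e.
Proof.
move=> dd bpsi.
have [U [UU ooU]] := @ultraFilterLemma nat eventually _.
have PU : ProperFilter U := @ultra_proper _ _ UU.
have /choice[L LP] : forall v, exists l, forall e : R, 0 < e ->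
    U [set n | `|psi n v - l| < e].
  move=> v.
  have [|l [_ cl]] := @segment_compact R (- `|v|) `|v| (psi ^~ v @ U) _.
    suff : U [set n | psi n v \in `[- `|v|, `|v|]] by [].
    apply: filterS filterT => n _ /=; rewrite in_itv/= -ler_norml.
    exact: (bpsi n).2.
  exists l => e e0; have [//|nU] := in_ultra_setVsetC [set n | `|psi n v - l| < e] UU.
  have lB : nbhs l [set z | `|z - l| < e].
    by apply/nbhs_ballP; exists e => // z /=; rewrite /ball/= distrC.
  by have [z [/= + /= ?]] := cl (~` [set z | `|z - l| < e]) _ nU lB.
have Lfin (vs : seq V) (e : R) N : 0 < e -> exists2 n, (N <= n)%N &
    forall v, v \in vs -> `|psi n v - L v| < e.
  move=> e0.
  have : U [set n | (N <= n)%N /\ forall v, v \in vs -> `|psi n v - L v| < e].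
    elim: vs => [|v vs IH].
      have : U [set n | (N <= n)%N] by apply: ooU; exists N.
      by apply: filterS => n /= Nn; split.
    apply: filterS (filterI IH (LP v e e0)) => n /= [[Nn h] hv].
    by split=> // w; rewrite inE => /predU1P[->//|/h].
  by move=> /filter_ex[n [Nn h]]; exists n.
have Lle (z : R) : (forall e, 0 < e -> z < e) -> z <= 0.
  by move=> h; rewrite leNgt; apply/negP => /h; rewrite ltxx.
have bL : dual_ball L.
  split=> [a u v|v].
    apply/subr0_eq/normr0_eq0/le_anti; rewrite normr_ge0 andbT.
    (* The three errors add up to at most [(|a| + 2) e'], which is less than [e]. *)
    apply: Lle => e e0; pose e' := e / (3 * (1 + `|a|)).
    have a0 : 0 <= `|a| by [].
    have e'0 : 0 < e' by rewrite divr_gt0// mulr_gt0//; lra.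
    have [n _ h] := Lfin [:: u; v; a *: u + v] e' 0%N e'0.
    have hu := h u (mem_head _ _).
    have hv : `|psi n v - L v| < e' by apply: h; rewrite !inE eqxx orbT.
    have := h (a *: u + v); rewrite !inE eqxx !orbT => /(_ isT).
    rewrite (bpsi n).1 => huv.
    have -> : L (a *: u + v) - (a * L u + L v) =
      a * (psi n u - L u) + (psi n v - L v) - (a * psi n u + psi n v - L (a *: u + v)).
      by ring.
    apply: le_lt_trans (ler_normB _ _) _.
    apply: le_lt_trans (lerD (ler_normD _ _) (lexx _)) _.
    rewrite normrM.
    have ha : `|a| * `|psi n u - L u| <= `|a| * e' by rewrite ler_wpM2l// ltW.
    have : e = `|a| * e' + e' + e' + e' + 2 * (`|a| * e') by rewrite /e'; field; lra.
    have : 0 <= `|a| * e' by rewrite mulr_ge0// ltW.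
    lra.
  rewrite -subr_le0; apply: Lle => e e0.
  have [n _ /(_ v (mem_head _ _)) h] := Lfin [:: v] e 0%N e0.
  have := (bpsi n).2 v; have := ler_normB (psi n v) (psi n v - L v).
  have -> : psi n v - (psi n v - L v) = L v by ring.
  lra.
exists L => //.
have /choice[s sP] : forall n, exists m, (n <= m)%N /\
    forall i, (i <= n)%N -> `|psi m (d i) - L (d i)| < n.+1%:R^-1.
  move=> n; have n0 : 0 < n.+1%:R^-1 :> R by rewrite invr_gt0.
  have [m nm h] := Lfin (map d (iota 0 n.+1)) _ n n0.
  by exists m; split=> // i ni; apply: h; apply: map_f; rewrite mem_iota.
exists s; split=> [n|v e e0]; first by case: (sP n).
have e3 : 0 < e / 3 by rewrite divr_gt0.
have [i vi] := dd v _ e3.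
pose M := Num.truncn (e / 3)^-1.
exists (maxn i M) => n; rewrite geq_max => /andP[ni nM].
have h := (sP n).2 i ni.
have nle : n.+1%:R^-1 < e / 3.
  rewrite invf_plt ?posrE//.
  apply: lt_le_trans (truncnS_gt (e / 3)^-1) _.
  by rewrite ler_nat ltnS.
have h1 := (bpsi (s n)).2 (v - d i); have h2 := bL.2 (v - d i).
rewrite dual_ballB// in h1; rewrite dual_ballB// in h2.
have -> : psi (s n) v - L v = (psi (s n) v - psi (s n) (d i)) +
   (psi (s n) (d i) - L (d i)) - (L v - L (d i)) by ring.
apply: le_lt_trans (ler_normB _ _) _.
apply: le_lt_trans (lerD (ler_normD _ _) (lexx _)) _.
have {}h := lt_trans h nle; lra.
Qed.

(* The Orlicz-Pettis theorem, by a gliding hump: otherwise there are bounded sets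
   [E n] going to infinity and functionals [psi n] in the dual ball with
   [psi n (nu (E n)) > e]; along a weak* convergent subsequence with limit [L],
   the union [A] of a sparse subfamily contradicts [psi n (nu A) -> L (nu A)]. *)
Lemma vanishing_at_infinity_of_weak (nu : set R -> V) (d : nat -> V) :
  (forall v (e : R), 0 < e -> exists n, `|v - d n| < e) ->
  (forall E F : set R, measurable E -> measurable F -> E `&` F = set0 ->
    nu (E `|` F) = nu E + nu F) ->
  (forall f, dual_ball f -> forall e : R, 0 < e -> exists r : R,
    forall E : set R, measurable E -> E `<=` [set t | r <= `|t|] -> `|f (nu E)| <= e) ->
  forall e : R, 0 < e -> exists r : R,
    forall E : set R, measurable E -> E `<=` [set t | r <= `|t|] -> `|nu E| <= e.
Proof.
move=> dd nuU weak e e0; apply: contrapT => nuN.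
have mout := @measurable_norm_ge R.
have mE' (r : R) : measurable [set t : R | `|t| < r].
  rewrite (_ : [set _ | _] = ~` [set t : R | r <= `|t|]); first exact: measurableC.
  by apply/seteqP; split=> t /=; rewrite ltNge => /negP.
have /choice[w wP] : forall n : nat, exists p : set R * R * (V -> R),
    [/\ measurable p.1.1, p.1.1 `<=` [set t | n%:R <= `|t| < p.1.2],
        dual_ball p.2 & e < p.2 (nu p.1.1)].
  move=> n.
  have [E [mE En] ltE] : exists2 E : set R, measurable E /\
      E `<=` [set t : R | n%:R <= `|t|] & e < `|nu E|.
    apply: contrapT => h; apply: nuN; exists n%:R => E mE En.
    by rewrite leNgt; apply/negP => ltE; apply: h; exists E.
  have [f bf fE] := norming_functional (nu E).
  (* Half the excess over [e]: cutting [E] at radius [r] costs at most [r0], so the bounded piece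
     still has value above [e]. *)
  pose r0 := (f (nu E) - e) / 2.
  have r00 : 0 < r0 by rewrite divr_gt0// fE; lra.
  have [r rP] := weak f bf _ r00.
  have mEr : measurable (E `&` [set t : R | `|t| < r]) by exact: measurableI.
  have mEr' : measurable (E `&` [set t : R | r <= `|t|]) by exact: measurableI.
  exists (E `&` [set t : R | `|t| < r], r, f); split=> //=.
    by move=> t [/En/= -> /= ->].
  have EE : E = (E `&` [set t : R | `|t| < r]) `|` (E `&` [set t : R | r <= `|t|]).
    rewrite -setIUr; apply/seteqP; split=> [t Et|t []//]; split=> //=.
    by have [|] := ltP `|t| r; [left|right].
  have := rP _ mEr' (@subIsetr _ _ _); rewrite ler_norml => /andP[_].
  have : f (nu E) = f (nu (E `&` [set t : R | `|t| < r])) +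
                    f (nu (E `&` [set t : R | r <= `|t|])).
    rewrite -dual_ballD// -nuU// -?EE//.
    apply/seteqP; split=> // t [[_ /=]] + [_ /=]; by rewrite ltNge => /negP.
  by move: ltE; rewrite /r0 -fE; lra.
have bw n : dual_ball (w n).2 by case: (wP n).
have [L bL [s [sge sL]]] := dual_ball_subsequence dd bw.
pose E n := (w (s n)).1.1; pose bd n := (w (s n)).1.2; pose psi n := (w (s n)).2.
have mE n : measurable (E n) by case: (wP (s n)).
have Ege n t : E n t -> n%:R <= `|t|.
  case: (wP (s n)) => _ + _ _ => /[apply]/= /andP[+ _]; apply: le_trans.
  by rewrite ler_nat.
have Elt n t : E n t -> `|t| < bd n.
  by case: (wP (s n)) => _ + _ _ => /[apply]/= /andP[].
have bpsi n : dual_ball (psi n) by case: (wP (s n)).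
have psiE n : e < psi n (nu (E n)) by case: (wP (s n)).
have e4 : 0 < e / 4 by rewrite divr_gt0.
have e8 : 0 < e / 8 by rewrite divr_gt0.
have /choice[rho rhoP] : forall n, exists r : R, forall E : set R,
    measurable E -> E `<=` [set t | r <= `|t|] ->
    `|psi n (nu E) - L (nu E)| <= e / 4.
  move=> n; have [r1 h1] := weak _ (bpsi n) _ e8.
  have [r2 h2] := weak _ bL _ e8.
  exists (Num.max r1 r2) => F mF Fr.
  have {}h1 : `|psi n (nu F)| <= e / 8.
    by apply: h1 => // t /Fr/=; rewrite ge_max => /andP[].
  have {}h2 : `|L (nu F)| <= e / 8.
    by apply: h2 => // t /Fr/=; rewrite ge_max => /andP[].
  by apply: le_trans (ler_normB _ _) _; lra.
have [rL hL] := weak _ bL _ e4.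
have truncge (z : R) n : (Num.truncn z < n)%N -> z <= n%:R.
  move=> zn; apply: le_trans (ltW (truncnS_gt z)) _.
  by rewrite ler_nat.
(* A state holds the last index [j], the union [G] of the humps chosen so far and a radius [C]
   bounding it. The next hump lies beyond [C], hence is disjoint from [G]; beyond [rho j], hence is
   negligible for [psi j - L]; and beyond [rL], where [L] is small. Its functional is already close
   to [L] at [nu G]. *)
have /choice[nxt nxtP] : forall p : nat * set R * R, exists n : nat,
    [/\ (p.1.1 < n)%N, p.2 <= n%:R, rho p.1.1 <= n%:R, rL <= n%:R &
        `|psi n (nu p.1.2) - L (nu p.1.2)| < e / 4].
  move=> [[j G] C] /=; have [N hN] := sL (nu G) _ e4.
  exists (\max_(i <- [:: j; Num.truncn C; Num.truncn (rho j); Num.truncn rL; N]) i).+1.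
  rewrite !big_cons big_nil maxn0; split; [lia|apply: truncge; lia|
    apply: truncge; lia|apply: truncge; lia|apply: hN; lia].
pose step (p : nat * set R * R) :=
  let n := nxt p in (n, p.1.2 `|` E n, Num.max p.2 (bd n)).
pose st k := iter k step (0%N, set0, 0).
pose j k := (st k).1.1; pose G k := (st k).1.2; pose C k := (st k).2.
have GS k : G k.+1 = G k `|` E (j k.+1) by [].
have CS k : C k.+1 = Num.max (C k) (bd (j k.+1)) by [].
have jP k : [/\ (j k < j k.+1)%N, C k <= (j k.+1)%:R, rho (j k) <= (j k.+1)%:R,
    rL <= (j k.+1)%:R & `|psi (j k.+1) (nu (G k)) - L (nu (G k))| < e / 4].
  exact: nxtP.
have mG k : measurable (G k).
  by elim: k => [|k IH]; [exact: measurable0|rewrite GS; exact: measurableU].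
have Glt k t : G k t -> `|t| < C k.
  by elim: k => [//|k IH] /=; rewrite GS CS lt_max => -[/IH ->//|/Elt ->]; rewrite orbT.
have jmono : {homo j : m n / (m <= n)%N}.
  by apply: homo_leq => //; [exact: leq_trans|move=> k; case: (jP k) => /ltnW].
have jge k : (k <= j k)%N.
  by elim: k => // k IH; apply: leq_ltn_trans IH _; case: (jP k).
pose A := \bigcup_k G k.
have mA : measurable A by apply: bigcup_measurable => k _; exact: mG.
have [N hN] := sL (nu A) _ e4.
pose i := j N.+1.
have Ni : (N <= i)%N by apply: leq_trans (jge _); exact: leqnSn.
have Gmono : {homo G : m n / (m <= n)%N >-> m `<=` n}.
  apply: homo_leq => [?|? ? ?|k t Gt]; [exact: subset_refl|exact: subset_trans|].
  by rewrite GS; left.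
have Grest l t : G l t -> G N.+1 t \/ (j N.+2)%:R <= `|t|.
  have [lN|] := leqP l N.+1; first by move/(Gmono _ _ lN); left.
  elim: l => [//|l IH] Nl; rewrite GS => -[Gt|Et].
    have [lN|lN] := leqP l N.+1; first by left; apply: Gmono lN _ Gt.
    exact: IH.
  by right; apply: le_trans (Ege _ _ Et); rewrite ler_nat jmono.
have AE : A = G N.+1 `|` (A `\` G N.+1).
  by rewrite setDE setUIr setUv setIT; apply/esym/setUidr; exact: bigcup_sup.
have disjGE : G N `&` E i = set0.
  apply/seteqP; split=> // t [/Glt tG /Ege tE].
  have [_ h _ _ _] := jP N; have := lt_le_trans tG h.
  by rewrite ltNge tE.
have mD : measurable (A `\` G N.+1) by apply: measurableD.
(* [A] is cut into the humps before [E i], the hump itself and the later ones. On [A] and on both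
   outer pieces [psi i - L] is at most [e / 4], and so is [L] on [E i]; together they force
   [psi i (nu (E i)) < e], a contradiction. *)
have : nu A = nu (G N) + nu (E i) + nu (A `\` G N.+1).
  rewrite {1}AE nuU//; last exact: setDIK.
  by rewrite GS nuU.
move=> nuA.
have h1 : `|psi i (nu A) - L (nu A)| < e / 4 by exact: hN.
have h2 : `|psi i (nu (G N)) - L (nu (G N))| < e / 4 by case: (jP N).
have h3 : `|psi i (nu (A `\` G N.+1)) - L (nu (A `\` G N.+1))| <= e / 4.
  apply: rhoP => // t [[l _ /Grest[//|+ _]]]; apply: le_trans.
  by case: (jP N.+1).
have h4 : `|L (nu (E i))| <= e / 4.
  apply: hL => // t /Ege /=; apply: le_trans; by case: (jP N).
have h5 := psiE i.
move: h1; rewrite nuA !dual_ballD//.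
move: h2 h3 h4; rewrite !ltr_norml !ler_norml.
lra.
Qed.

End orlicz_pettis.

(** * Invariance of Lebesgue integrals *)

Section lebesgue_transfer.
Context (R : realType).

Lemma measurable_fun_shift (t : R) : measurable_fun [set: R] (fun s : R => s + t).
Proof.
by apply: continuous_measurable_fun => s; apply: cvgD => //; exact: cvg_cst.
Qed.

Lemma measurable_shift (t : R) (E : set R) :
  measurable E -> measurable ((fun s : R => s - t) @^-1` E).
Proof.
by move=> mE; rewrite -[X in measurable X]setTI; exact: measurable_fun_shift.
Qed.

Lemma measurable_opp (E : set R) :
  measurable E -> measurable (-%R @^-1` E : set R).
Proof.
move=> mE; rewrite -[X in measurable X]setTI.
have : measurable_fun [set: R] (-%R : R -> R).
  by apply: continuous_measurable_fun; exact: oppr_continuous.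
exact.
Qed.

Lemma lebesgue_measure_shift (t : R) (A : set R) : measurable A ->
  lebesgue_measure ((fun s : R => s + t) @^-1` A) = lebesgue_measure A.
Proof.
move=> mA; have mt := measurable_fun_shift t.
rewrite -[LHS]/(pushforward lebesgue_measure
  ((fun s : R => s + t) : measurableTypeR R -> measurableTypeR R) A).
apply/esym/lebesgue_measure_unique => //= _ [[a b]] _ <-.
rewrite /pushforward (_ : _ @^-1` _ = `](a - t), (b - t)]%classic).
  rewrite !lebesgue_measure_itv/= !lte_fin ltrD2r.
  by case: ifP => // _; rewrite -!EFinB; congr EFin; ring.
by apply/seteqP; split=> s /=; rewrite !in_itv/= ltrBlDr lerBrDr.
Qed.

(** The common change of variables behind three transfers: the identity from the completed
    sigma-algebra to the Borel one, translations, and the reflection [t |-> - t]. *)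
Lemma integral_measure_preserving d (Y : measurableType d)
    (m : {measure set Y -> \bar R}) (phi : Y -> R) (f : R -> R) (D : set R) :
  measurable_fun setT (phi : Y -> measurableTypeR R) ->
  (forall A : set R, measurable A -> m (phi @^-1` A) = lebesgue_measure A) ->
  measurable_fun setT f -> measurable D ->
  m.-integrable (phi @^-1` D) (EFin \o (f \o phi)) ->
  lebesgue_measure.-integrable D (EFin \o f) /\
  \int[lebesgue_measure]_(t in D) f t = \int[m]_(y in phi @^-1` D) f (phi y).
Proof.
move=> mphi mE mf mD intf.
have mEf : measurable_fun [set: measurableTypeR R] (EFin \o f).
  exact/measurable_EFinP.
have muE (g : R -> \bar R) : (\int[lebesgue_measure]_(t in D) g t =
    \int[pushforward m (phi : Y -> measurableTypeR R)]_(t in D) g t)%E.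
  by apply: eq_measure_integral => //= A mA _; rewrite /pushforward mE.
split.
  apply/integrableP; split; first exact: measurable_funTS.
  rewrite muE; have /integrableP[_] := integrable_pushforward mphi mEf intf mD.
  exact: le_lt_trans.
by rewrite /Rintegral muE; congr fine; exact: (integral_pushforward mphi mEf intf mD).
Qed.

Local Notation cmu := (@completed_lebesgue_measure R).

Lemma borel_lebesgue_measurable (A : set R) :
  measurable A -> lebesgue_measurable A.
Proof. by move=> mA; apply: sub_caratheodory. Qed.

(** Pettis integrability speaks of the completed measure, the vector measures of Borel sets. For
    Borel functions the identity map is measure preserving between the two settings. *)
Lemma completed_integral (f : R -> R) (D : set R) :
  measurable_fun setT f -> measurable D -> cmu.-integrable D (EFin \o f) ->
  lebesgue_measure.-integrable D (EFin \o f) /\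
  \int[lebesgue_measure]_(t in D) f t = \int[cmu]_(t in D) f t.
Proof.
move=> mf mD intf.
have mid : measurable_fun setT
    (id : caratheodory_type (wlength idfun)^*%mu -> measurableTypeR R).
  by move=> _ A mA; rewrite setTI; exact: borel_lebesgue_measurable.
have idE (A : set R) : measurable A -> cmu (id @^-1` A) = lebesgue_measure A.
  by move=> _.
exact: integral_measure_preserving mid idE mf mD intf.
Qed.

Lemma Rintegral_shift (f : R -> R) (D : set R) (t : R) :
  measurable_fun setT f -> measurable D ->
  lebesgue_measure.-integrable setT (EFin \o f) ->
  \int[lebesgue_measure]_(s in (fun s => s - t) @^-1` D) f s =
  \int[lebesgue_measure]_(s in D) f (s + t).
Proof.
move=> mf mD intf.
have mshift := measurable_fun_shift.
have mD' : measurable ((fun s => s - t) @^-1` D) by exact: measurable_shift.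
have intf' : lebesgue_measure.-integrable setT (EFin \o (fun s => f (s + t))).
  have [||||//] := @integral_measure_preserving _ _ lebesgue_measure
    (fun s : R => s - t) (fun s => f (s + t)) setT (mshift (- t)).
  - exact: lebesgue_measure_shift.
  - exact: measurableT_comp (mshift t).
  - exact: measurableT.
  - rewrite preimage_setT; apply: eq_integrable intf => // s _ /=.
    by rewrite subrK.
have DE : (fun s => s + t) @^-1` ((fun s => s - t) @^-1` D) = D.
  by apply/seteqP; split=> s /=; rewrite addrK.
have [||_ ->] := @integral_measure_preserving _ _ lebesgue_measure
  (fun s : R => s + t) f ((fun s => s - t) @^-1` D) (mshift t) _ mf mD'.
- exact: lebesgue_measure_shift.
- by rewrite DE; exact: integrableS intf'.
- by rewrite DE.
Qed.

Lemma Rintegral_opp (f : R -> R) (D : set R) :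
  measurable_fun setT f -> measurable D ->
  lebesgue_measure.-integrable (-%R @^-1` D) (EFin \o (f \o -%R)) ->
  lebesgue_measure.-integrable D (EFin \o f) /\
  \int[lebesgue_measure]_(t in D) f t =
  \int[lebesgue_measure]_(t in -%R @^-1` D) f (- t).
Proof.
move=> mf mD intf; apply: integral_measure_preserving => //.
exact: lebesgue_measureN.
Qed.

End lebesgue_transfer.

Lemma lebesgue_integrableT (R : realType) (f : R -> \bar R) (E : set R) :
  lebesgue_measure.-integrable setT f -> measurable E ->
  lebesgue_measure.-integrable E f.
Proof. by move=> intf mE; exact: integrableS intf. Qed.

(** Dominated convergence for [|f|] cut off to [n <= |t|]: at each point the cut-offs are eventually
    zero, and [|f|] dominates them. *)
Lemma integral_vanishing_at_infinity (R : realType) (f : R -> R) :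
  lebesgue_measure.-integrable setT (EFin \o f) ->
  forall e : R, 0 < e -> exists r : R, forall E : set R,
    measurable E -> E `<=` [set t | r <= `|t|] ->
    `|\int[lebesgue_measure]_(t in E) f t| <= e.
Proof.
move=> intf e e0; have /integrableP[mf _] := intf.
have mabs : measurable_fun setT (abse \o (EFin \o f)) by exact: measurableT_comp.
have iabs : lebesgue_measure.-integrable setT (abse \o (EFin \o f)).
  exact: integrable_abse.
pose D (n : nat) := [set t : R | n%:R <= `|t|].
have mD n : measurable (D n) := measurable_norm_ge _.
have [] := @dominated_convergence _ _ R lebesgue_measure setT measurableT
  (fun n => (abse \o (EFin \o f)) \_ (D n)) (cst 0%E) (abse \o (EFin \o f)).
- move=> n; apply/(measurable_restrictT _ (mD n)).
  exact: measurable_funTS.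
- exact: measurable_cst.
- apply: aeW => /= x _; apply: cvg_near_cst; exists (Num.truncn `|x|).+1 => // n /= xn.
  rewrite patchE ifN// notin_setE /D/= => nx.
  have := lt_le_trans (truncnS_gt `|x|) (le_trans _ nx).
  by rewrite ler_nat => /(_ xn); rewrite ltxx.
- exact: iabs.
- apply: aeW => /= x n _; rewrite patchE; case: ifPn => _; last by rewrite abse0.
  by rewrite abse_id.
move=> _ _; rewrite integral0 => /fine_cvgP[_ /cvgrPdist_le/(_ e e0)[N _ hN]].
exists N%:R => E mE EN; have {hN} := hN N (leqnn N).
rewrite /= sub0r normrN -integral_mkcond => hN.
have iE : lebesgue_measure.-integrable E (EFin \o f) by exact: lebesgue_integrableT.
rewrite -lee_fin EFin_normr_Rintegral//.
have /integrableP[mEf _] := iE.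
apply: (le_trans (le_abse_integral lebesgue_measure mE mEf)).
apply: (le_trans (@ge0_subset_integral _ _ _ lebesgue_measure E (D N) mE (mD N)
  (abse \o (EFin \o f)) (measurable_funTS mabs) _ EN)) => [x _|].
  exact: abse_ge0.
have iD : lebesgue_measure.-integrable (D N) (abse \o (EFin \o f)).
  by apply: lebesgue_integrableT iabs _; exact: mD.
rewrite -[leLHS]fineK ?lee_fin; first exact: le_trans (ler_norm _) hN.
by apply: integrable_fin_num iD; exact: mD.
Qed.

(** * Vector measures of trajectories *)

Section trajectory_measure.
Context (R : realType) (V : normedModType R) (T : R -> V -> V).

(** What the coding asks of a measure: additivity lets common symbols of two codings cancel,
    equivariance turns the shift into the semigroup, and decay at infinity makes distant symbols
    negligible. *)
Definition trajectory_measure (nu : set R -> V) : Prop :=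
  [/\ forall E F : set R, measurable E -> measurable F -> E `&` F = set0 ->
        nu (E `|` F) = nu E + nu F,
      forall (t : R) (E : set R), 0 <= t -> measurable E ->
        T t (nu E) = nu ((fun s => s - t) @^-1` E)
    & forall e : R, 0 < e -> exists r : R, forall E : set R, measurable E ->
        E `<=` [set t | r <= `|t|] -> `|nu E| <= e].

(** Makes [f] composed with [T t] available as a test functional. The factor [1 / (1 + |M|)] is
    positive whatever [M] is. *)
Lemma dual_ball_comp (A : V -> V) (M : R) (f : V -> R) :
  linear A -> (forall v, `|A v| <= M * `|v|) -> dual_ball f ->
  exists2 c : R, 0 < c & dual_ball (fun v => c * f (A v)).
Proof.
move=> Alin AM [flin fle]; have M0 : 0 < 1 + `|M| by have := normr_ge0 M; lra.
exists (1 + `|M|)^-1; first by rewrite invr_gt0.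
split=> [a u v|v]; first by rewrite Alin flin; ring.
rewrite normrM gtr0_norm ?invr_gt0// ler_pdivrMl//.
apply: le_trans (fle _) _; apply: le_trans (AM _) _.
by rewrite ler_wpM2r//; apply: le_trans (ler_norm M) _; rewrite lerDr.
Qed.

(** Additivity and equivariance are tested on the dual ball, which separates points; decay in norm
    comes from decay of the scalar integrals by the Orlicz-Pettis argument. *)
Lemma trajectory_measure_exists (g : R -> V) (nu : set R -> V) (d : nat -> V) :
  (forall v (e : R), 0 < e -> exists n, `|v - d n| < e) ->
  (forall t : R, 0 <= t -> linear (T t)) ->
  (forall t : R, 0 <= t -> exists M : R, forall v, `|T t v| <= M * `|v|) ->
  (forall t s : R, 0 <= t -> T t (g s) = g (s + t)) ->
  (forall f, dual_ball f -> measurable_fun setT (f \o g)) ->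
  (forall f, dual_ball f -> lebesgue_measure.-integrable setT (EFin \o (f \o g))) ->
  (forall f, dual_ball f -> forall E : set R, measurable E ->
    f (nu E) = \int[lebesgue_measure]_(s in E) f (g s)) ->
  trajectory_measure nu.
Proof.
move=> dd Tlin Tbnd Tg mg ig nuE.
have nuU (E F : set R) : measurable E -> measurable F -> E `&` F = set0 ->
    nu (E `|` F) = nu E + nu F.
  move=> mE mF EF; apply: dual_ball_sep => f bf; rewrite dual_ballD// !nuE//.
    apply: Rintegral_setU => //; last by apply/disj_setPS; rewrite EF.
    by apply: lebesgue_integrableT (ig f bf) _; exact: measurableU.
  exact: measurableU.
split=> // [t E t0 mE|].
  have mE' : measurable ((fun s => s - t) @^-1` E) by exact: measurable_shift.
  apply: dual_ball_sep => f bf.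
  have [M TM] := Tbnd t t0.
  have [c c0 bh] := dual_ball_comp (Tlin t t0) TM bf.
  apply: (mulfI (lt0r_neq0 c0)); rewrite (nuE _ bh)// nuE// Rintegral_shift//.
  - rewrite -RintegralZl//.
      by apply: eq_Rintegral => s _; rewrite Tg.
    have iE := lebesgue_integrableT (ig _ bh) mE.
    have icE : lebesgue_measure.-integrable E
        (fun s => c^-1%:E * (EFin \o ((fun v => c * f (T t v))%R \o g)) s)%E.
      exact: integrableZl.
    apply: eq_integrable icE => // s _ /=.
    by rewrite -EFinM mulKf ?lt0r_neq0// Tg.
  - exact: mg.
  - exact: ig.
apply: (vanishing_at_infinity_of_weak dd) => // f bf e e0.
have [r hr] := integral_vanishing_at_infinity (ig f bf) e0.
by exists r => E mE Er; rewrite nuE//; exact: hr.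
Qed.

End trajectory_measure.

(** * Trajectories supplied by the criterion *)

Section criterion_trajectory.
Context (R : realType) (V : normedModType R) (T : R -> V -> V).

Local Notation cmu := (@completed_lebesgue_measure R).

(** Only real functionals of norm at most 1 are tested, a form that real and complex spaces both
    supply. *)
Definition real_pettis_integrable (f : R -> V) : Prop :=
  (forall psi, dual_ball psi ->
     cmu.-integrable `[0, +oo[ (EFin \o (psi \o f))) /\
  (forall E : set R, lebesgue_measurable E -> E `<=` `[0, +oo[ ->
     exists xE : V, forall psi, dual_ball psi ->
       psi xE = \int[cmu]_(t in E) psi (f t)).

Definition metric_C0_semigroup : Prop :=
  [/\ (forall t : R, 0 <= t -> linear (T t)) /\
      (forall t : R, 0 <= t -> exists M : R, forall v, `|T t v| <= M * `|v|),
      forall v, T 0 v = v,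
      forall (t s : R) (v : V), 0 <= t -> 0 <= s -> T t (T s v) = T (t + s) v
    & forall (v : V) (s e : R), 0 <= s -> 0 < e -> exists2 r : R, 0 < r &
        forall t, 0 <= t -> `|t - s| < r -> `|T t v - T s v| < e].

Lemma pettis_measure (f : R -> V) : real_pettis_integrable f ->
  exists nu : set R -> V, forall E : set R,
    measurable E -> E `<=` `[0, +oo[ -> forall psi, dual_ball psi ->
      psi (nu E) = \int[cmu]_(t in E) psi (f t).
Proof.
move=> [_ fE].
suff /choice[nu nuP] : forall E : set R, exists v, measurable E ->
    E `<=` `[0, +oo[ -> forall psi, dual_ball psi ->
    psi v = \int[cmu]_(t in E) psi (f t) by exists nu.
move=> E; have [[mE E0]|nE] := pselect (measurable E /\ E `<=` `[0, +oo[).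
  have [v vP] := fE E (borel_lebesgue_measurable mE) E0.
  by exists v => _ _; exact: vP.
by exists 0 => mE E0; case: nE.
Qed.

Context (S : R -> V -> V) (x : V).
Hypotheses (Tsg : metric_C0_semigroup)
  (TSK : forall t : R, 0 < t -> T t (S t x) = x)
  (TSB : forall t r : R, 0 < t -> t < r -> T t (S r x) = S (r - t) x)
  (pettisT : real_pettis_integrable (fun t => T t x))
  (pettisS : real_pettis_integrable (fun t => S t x)).

Let g (s : R) : V := if 0 <= s then T s x else S (- s) x.

Let Tg (t s : R) : 0 <= t -> T t (g s) = g (s + t).
Proof.
have [_ T0 TD _] := Tsg.
move=> t0; rewrite /g; have [s0|s0] := leP 0 s.
  by rewrite addr_ge0// TD// addrC.
have [st0|st0] := leP 0 (s + t).
  have -> : t = (s + t) + - s by ring.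
  rewrite -TD ?TSK//; first by congr T; ring.
  - by rewrite oppr_gt0.
  - by rewrite oppr_ge0 ltW.
move: t0; rewrite le_eqVlt => /predU1P[<-|t0]; first by rewrite T0 addr0.
rewrite TSB//; first by congr S; ring.
by lra.
Qed.

(** Near [s] the trajectory is an orbit, [g t = T (t + u) (g (- u))] with [u = |s| + 1], so strong
    continuity of the semigroup passes to [g], the part built from [S] included. *)
Let g_continuous (s e : R) : 0 < e ->
  exists2 r : R, 0 < r & forall t, `|t - s| < r -> `|g t - g s| < e.
Proof.
have [_ _ _ Tc] := Tsg.
move=> e0; pose u := `|s| + 1.
have su : 0 <= s + u by have := ler_norm (- s); rewrite normrN /u; lra.
have [r r0 rP] := Tc (g (- u)) (s + u) e su e0.
exists (Num.min r 1); first by rewrite lt_min r0 ltr01.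
move=> t; rewrite lt_min => /andP[tr t1].
have tu : 0 <= t + u.
  have := ler_norm (- s); have := ler_norm (- (t - s)); rewrite !normrN /u; lra.
have gE w : 0 <= w + u -> g w = T (w + u) (g (- u)).
  by move=> wu; rewrite Tg//; congr g; ring.
rewrite (gE t)// (gE s)//; apply: rP => //.
by rewrite (_ : _ - _ = t - s)//; ring.
Qed.

Let measurable_g psi : dual_ball psi -> measurable_fun setT (psi \o g).
Proof.
move=> bpsi; apply: continuous_measurable_fun => s.
apply/cvgrPdist_lt => e e0; have [r r0 rP] := g_continuous s e0.
apply/nbhs_ballP; exists r => // t; rewrite /ball/= distrC => /rP h.
rewrite distrC -dual_ballB//; apply: le_lt_trans h; exact: bpsi.2.
Qed.

Let gT (E : set R) : E `<=` `[0, +oo[ -> {in E, g =1 fun t => T t x}.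
Proof.
by move=> E0 t /set_mem/E0; rewrite /g/= in_itv/= andbT => ->.
Qed.

(** The half-line is open because [g 0] is [T 0 x], whereas [S 0 x] is arbitrary. *)
Let gS (E : set R) : E `<=` `]0, +oo[ -> {in E, g \o -%R =1 fun t => S t x}.
Proof.
move=> E0 t /set_mem/E0; rewrite /g/= in_itv/= andbT oppr_ge0 leNgt => ->/=.
by rewrite opprK.
Qed.

Let integral_gT psi (E : set R) : dual_ball psi -> measurable E ->
  E `<=` `[0, +oo[ ->
  lebesgue_measure.-integrable E (EFin \o (psi \o g)) /\
  \int[lebesgue_measure]_(t in E) psi (g t) = \int[cmu]_(t in E) psi (T t x).
Proof.
move=> bpsi mE E0; have cE := borel_lebesgue_measurable mE.
have iE : cmu.-integrable E (EFin \o (psi \o g)).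
  have i0 : cmu.-integrable E (EFin \o (psi \o fun t => T t x)).
    apply: integrableS (pettisT.1 psi bpsi) => //.
    by apply: borel_lebesgue_measurable; exact: measurable_itv.
  by apply: eq_integrable i0 => // t tE /=; rewrite (gT E0).
have [? ->] := completed_integral (measurable_g bpsi) mE iE; split=> //.
by apply: eq_Rintegral => t tE /=; rewrite (gT E0).
Qed.

Let integral_gS psi (E : set R) : dual_ball psi -> measurable E ->
  E `<=` `]-oo, 0[ ->
  lebesgue_measure.-integrable E (EFin \o (psi \o g)) /\
  \int[lebesgue_measure]_(t in E) psi (g t) =
  \int[cmu]_(t in -%R @^-1` E) psi (S t x).
Proof.
move=> bpsi mE E0.
have mN : measurable_fun [set: R] (-%R : R -> R).
  by apply: continuous_measurable_fun; exact: oppr_continuous.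
have mE' : measurable (-%R @^-1` E) by exact: measurable_opp.
have cE := borel_lebesgue_measurable mE'.
have E'0 : -%R @^-1` E `<=` `]0, +oo[.
  by move=> t /E0/=; rewrite !in_itv/= andbT oppr_lt0.
have E'1 : -%R @^-1` E `<=` `[0, +oo[.
  by move=> t /E'0/=; rewrite !in_itv/= !andbT; exact: ltW.
have iE : cmu.-integrable (-%R @^-1` E) (EFin \o (psi \o (g \o -%R))).
  have i0 : cmu.-integrable (-%R @^-1` E) (EFin \o (psi \o fun t => S t x)).
    apply: integrableS (pettisS.1 psi bpsi) => //.
    by apply: borel_lebesgue_measurable; exact: measurable_itv.
  by apply: eq_integrable i0 => // t tE /=; rewrite -(gS E'0).
have mgN : measurable_fun setT (psi \o (g \o -%R)).
  exact: measurableT_comp (measurable_g bpsi) mN.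
have [iE' eE] := completed_integral mgN mE' iE.
have [? ->] := Rintegral_opp (measurable_g bpsi) mE iE'; split=> //.
rewrite [LHS]eE.
by apply: eq_Rintegral => t tE /=; rewrite -(gS E'0).
Qed.

Let splitE (E : set R) : E = (E `&` `[0, +oo[) `|` (E `&` `]-oo, 0[).
Proof.
rewrite -setIUr; apply/seteqP; split=> [t Et|t []//]; split=> //=.
by rewrite !in_itv/= andbT; have [|] := leP 0 t; [left|right].
Qed.

Let splitI (E : set R) : (E `&` `[0, +oo[) `&` (E `&` `]-oo, 0[) = set0.
Proof.
apply/seteqP; split=> // t [[_ /=]]; rewrite in_itv/= andbT => t0 [_ /=].
by rewrite in_itv/= ltNge t0.
Qed.

Let integrable_g psi : dual_ball psi ->
  lebesgue_measure.-integrable setT (EFin \o (psi \o g)).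
Proof.
move=> bpsi; apply/integrableP; split.
  by apply/measurable_EFinP; exact: measurable_g.
have mA : measurable (`[0, +oo[ : set R) by exact: measurable_itv.
have mB : measurable (`]-oo, 0[ : set R) by exact: measurable_itv.
have /integrableP[_ iA] := (integral_gT bpsi mA (@subset_refl _ _)).1.
have /integrableP[_ iB] := (integral_gS bpsi mB (@subset_refl _ _)).1.
rewrite [X in integral _ X _](splitE setT) !setTI ge0_integral_setU//.
- exact: lte_add_pinfty.
- apply: measurable_funTS; apply: measurableT_comp => //.
  by apply/measurable_EFinP; exact: measurable_g.
- by apply/disj_setPS; have := splitI setT; rewrite !setTI => ->.
Qed.

(** By continuity at 0 the averages of [T s x] over [[0, h[] tend to [x]; this is the source of
    density of the coded points. The bound [b] will be the period [t0], so that a block fits into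
    one step of the shift. *)
Lemma criterion_trajectory (d : nat -> V) :
  (forall v (e : R), 0 < e -> exists n, `|v - d n| < e) ->
  exists2 nu, trajectory_measure T nu &
    forall e b : R, 0 < e -> 0 < b ->
      exists2 h, 0 < h <= b & `|h^-1 *: nu `[0, h[%classic - x| <= e.
Proof.
move=> dd; have [nuT nuTP] := pettis_measure pettisT.
have [nuS nuSP] := pettis_measure pettisS.
pose nu E := nuT (E `&` `[0, +oo[) + nuS (-%R @^-1` (E `&` `]-oo, 0[)).
have nuE psi : dual_ball psi -> forall E : set R, measurable E ->
    psi (nu E) = \int[lebesgue_measure]_(s in E) psi (g s).
  move=> bpsi E mE.
  have mA : measurable (E `&` `[0, +oo[).
    by apply: measurableI => //; exact: measurable_itv.
  have mB : measurable (E `&` `]-oo, 0[).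
    by apply: measurableI => //; exact: measurable_itv.
  have mB' : measurable (-%R @^-1` (E `&` `]-oo, 0[)) by exact: measurable_opp.
  rewrite dual_ballD// nuTP// nuSP//; last first.
    by move=> t [_ /=]; rewrite !in_itv/= andbT oppr_lt0; exact: ltW.
  rewrite [in RHS](splitE E) Rintegral_setU//.
  - by congr +%R; [rewrite (integral_gT bpsi mA _).2|rewrite (integral_gS bpsi mB _).2].
  - by rewrite -splitE; apply: lebesgue_integrableT => //; exact: integrable_g.
  - by apply/disj_setPS; rewrite splitI.
have [[Tlin Tbnd] T0 _ Tc] := Tsg.
exists nu.
  exact: (trajectory_measure_exists dd Tlin Tbnd Tg measurable_g integrable_g nuE).
move=> e b e0 b0; have [r r0 rP] := Tc x 0 e (lexx _) e0.
exists (Num.min r b); first by rewrite lt_min r0 b0 ge_min lexx orbT.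
set h := Num.min r b; have h0 : 0 < h by rewrite lt_min r0 b0.
have mh : measurable (`[0, h[ : set R) by exact: measurable_itv.
(* A norming functional reduces the norm estimate to the scalar one [psi (g s) <= e + psi x] under
   the integral. *)
have [psi bpsi <-] := norming_functional (h^-1 *: nu `[0, h[%classic - x).
rewrite dual_ballB//.
have -> : psi (h^-1 *: nu `[0, h[%classic) = h^-1 * psi (nu `[0, h[%classic).
  have := bpsi.1 h^-1 (nu `[0, h[%classic) 0.
  have := dual_ballB bpsi 0 0; rewrite !subrr => ->.
  by rewrite !addr0.
rewrite lerBlDr ler_pdivrMl// nuE//.
have -> : h * (e + psi x) = \int[lebesgue_measure]_(s in `[0, h[) (e + psi x).
  by rewrite Rintegral_cst//= lebesgue_measure_itv/= lte_fin h0 -EFinB/= subr0 mulrC.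
apply: le_Rintegral => //.
- by apply: lebesgue_integrableT => //; exact: integrable_g.
- apply/integrableP; split; first exact: measurable_cst.
  by rewrite /= integral_cst//= lebesgue_measure_itv/= lte_fin h0 -EFinB -EFinM ltry.
move=> s /=; rewrite in_itv/= => /andP[s0 sh].
have /ltW : `|T s x - T 0 x| < e.
  apply: rP => //; rewrite subr0 ger0_norm//; apply: lt_le_trans sh _.
  by rewrite ge_min lexx.
rewrite T0 -lerBlDr -dual_ballB// /g s0; apply: le_trans.
exact: le_trans (ler_norm _) (bpsi.2 _).
Qed.

End criterion_trajectory.

(** * Coding by the full shift *)

Section shift_coding.
Context (R : realType) (V : normedModType R) (T : R -> V -> V).
Context (t0 : R) (Y : nat -> set R -> V) (h : nat -> R).
Hypotheses (Tlin : forall t : R, 0 <= t -> linear (T t)) (t0_gt0 : 0 < t0)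
  (h_le : forall i, h i <= t0)
  (Ytraj : forall i, trajectory_measure T (Y i)) (Y0 : forall E, Y 0 E = 0).

Let TB t u v : 0 <= t -> T t (u - v) = T t u - T t v.
Proof. by move=> t_ge0; rewrite -[u - v]addrC -scaleN1r Tlin// scaleN1r addrC. Qed.

Let TD t u v : 0 <= t -> T t (u + v) = T t u + T t v.
Proof. by move=> t_ge0; have := Tlin t_ge0 1 u v; rewrite !scale1r. Qed.

Let Tsum t m (F : nat -> V) : 0 <= t ->
  T t (\sum_(i < m) F i) = \sum_(i < m) T t (F i).
Proof.
move=> t_ge0; elim: m => [|m IH].
  by rewrite !big_ord0; have := TB 0 0 t_ge0; rewrite !subrr.
by rewrite !big_ord_recr/= TD// IH.
Qed.

(* The half-open intervals of length [h i] starting at [- n * t0], [n] in [A]. *)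
Definition comb (i : nat) (A : set int) : set R :=
  [set s | exists2 n, A n & 0 <= s + n%:~R * t0 < h i].

(** Symbol [i] at position [n] contributes the [Y i]-measure of an interval starting at [- n * t0],
    which the semigroup brings to the origin at time [n * t0]. Symbol 0 is a blank, as [Y 0]
    vanishes. *)
Definition coded_point (m : nat) (al : int -> nat) : V :=
  \sum_(i < m.+1) Y i (comb i [set n | al n = i]).

Let measurable_comb i A : measurable (comb i A).
Proof.
have -> : comb i A = \bigcup_(n in A) `[- (n%:~R * t0), h i - n%:~R * t0[%classic.
  apply/seteqP; split=> s [n An]; rewrite ?in_itv => /= sn; exists n => //=.
    by rewrite in_itv/= ltrBrDr lerNl -subr_ge0 opprK addrC.
  by move: sn; rewrite in_itv/= ltrBrDr lerNl -subr_ge0 opprK addrC.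
rewrite bigcup_mkcond; apply: countable_bigcupT_measurable => [|n].
  exact: countableP.
by case: ifP => // _; exact: measurable_itv.
Qed.

(** The bound [h i <= t0] enters here: intervals starting at distinct multiples of [t0] do not
    overlap. *)
Let comb_setI i A B : A `&` B = set0 -> comb i A `&` comb i B = set0.
Proof.
move=> AB; apply/seteqP; split=> // s [[n An /andP[n0 n1]] [k Bk /andP[k0 k1]]].
suff nk : n = k by have /seteqP[/(_ n) + _] := AB; apply; split=> //; rewrite nk.
have hi := h_le i.
have lt1 (u v : int) : 0 <= s + u%:~R * t0 -> s + v%:~R * t0 < h i -> (v <= u)%R.
  move=> u0 v1; have : v%:~R * t0 < (u + 1)%:~R * t0.
    by rewrite rmorphD/= mulrDl mul1r; lra.
  by rewrite ltr_pM2r// ltr_int -ltzD1.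
by apply/le_anti; rewrite !lt1.
Qed.

Let comb_setU i A B : comb i (A `|` B) = comb i A `|` comb i B.
Proof.
apply/seteqP; split=> s.
  by move=> [n [An|Bn] sn]; [left|right]; exists n.
by move=> [[n An sn]|[n Bn sn]]; exists n => //; [left|right].
Qed.

Let Y_combU i A B : A `&` B = set0 ->
  Y i (comb i (A `|` B)) = Y i (comb i A) + Y i (comb i B).
Proof.
move=> AB; rewrite comb_setU; have [-> //] := Ytraj i.
exact: comb_setI.
Qed.

Let Y_comb0 i : Y i (comb i set0) = 0.
Proof.
have := @Y_combU i set0 set0 (setI0 _); rewrite setU0.
by move=> /eqP; rewrite -subr_eq0 opprD addNKr oppr_eq0 => /eqP.
Qed.

Lemma coded_point_shift m al (l : nat) :
  T (l%:R * t0) (coded_point m al) = coded_point m (fun n => al (n + l%:Z)).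
Proof.
have lt0 : 0 <= l%:R * t0 by rewrite mulr_ge0// ltW.
rewrite /coded_point (Tsum _ (fun i => Y i (comb i [set n | al n = i])))//.
apply: eq_bigr => i _.
have [_ -> // _] := Ytraj i; congr (Y i _); apply/seteqP; split=> s /=.
  move=> [n An sn]; exists (n - l%:Z); first by rewrite /= subrK.
  by rewrite rmorphB/= mulrBl addrA addrAC.
move=> [n An sn]; exists (n + l%:Z) => //.
by rewrite rmorphD/= mulrDl addrAC addrA addrK.
Qed.

(** Symbols on which [al] and [be] agree cancel by additivity. A disagreement at [n] has [n * t0]
    farther than [r] from [t], so [T t] carries its interval far from the origin, where the [Y i]
    are small. *)
Lemma coded_point_tracking m (e : R) : 0 < e -> exists2 r : R, 0 <= r &
  forall al be (t : R), 0 <= t ->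
    (forall n : int, `|n%:~R * t0 - t| <= r -> al n = be n) ->
    `|T t (coded_point m al) - T t (coded_point m be)| < e.
Proof.
(* Each of the [m + 1] symbols leaves two error terms, one per coding, for a total of at most
   [e / 2]. *)
move=> e_gt0; pose c := e / (4 * m.+1%:R).
have c0 : 0 < c by rewrite divr_gt0// mulr_gt0.
have /choice[rad radP] : forall i, exists r : R, forall E : set R, measurable E ->
    E `<=` [set t | r <= `|t|] -> `|Y i E| <= c.
  by move=> i; case: (Ytraj i) => _ _; exact.
(* The sum dominates every [rad i], and [t0] accounts for the length of an interval. *)
pose r := \sum_(i < m.+1) `|rad i| + t0.
exists r; first by apply: addr_ge0; [exact: sumr_ge0|exact: ltW].
move=> al be t t_ge0 ab.
rewrite -TB// /coded_point -sumrB (Tsum _ (fun i =>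
  Y i (comb i [set n | al n = i]) - Y i (comb i [set n | be n = i])))//.
apply: (@le_lt_trans _ _ (\sum_(i < m.+1) (c + c))); last first.
  rewrite sumr_const card_ord -mulr_natr.
  have -> : (c + c) * m.+1%:R = e / 2.
    have : 0 < m.+1%:R :> R by [].
    by rewrite /c; move: (m.+1%:R : R) => k k0; field; rewrite lt0r_neq0.
  lra.
apply: le_trans (ler_norm_sum _ _ _) _; apply: ler_sum => i _.
pose A := [set n | al n = i]; pose B := [set n | be n = i].
have AE : A = (A `&` B) `|` (A `\` B) by rewrite setUIDK.
have BE : B = (A `&` B) `|` (B `\` A) by rewrite setIC setUIDK.
have YA : Y i (comb i A) = Y i (comb i (A `&` B)) + Y i (comb i (A `\` B)).
  by rewrite {1}AE Y_combU//; apply/seteqP; split=> // n [[? ?] []].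
have YB : Y i (comb i B) = Y i (comb i (A `&` B)) + Y i (comb i (B `\` A)).
  by rewrite {1}BE Y_combU//; apply/seteqP; split=> // n [[? ?] []].
rewrite -/A -/B YA YB opprD addrACA subrr add0r TB//.
apply: le_trans (ler_normB _ _) _.
have small (D : set int) : (forall n, D n -> al n <> be n) ->
    `|T t (Y i (comb i D))| <= c.
  move=> Dab; have [_ -> // _] := Ytraj i.
  apply: radP; first exact: measurable_shift.
  move=> s [n /Dab nD /andP[n0 n1]] /=.
  have rn : r < `|n%:~R * t0 - t|.
    by rewrite ltNge; apply/negP => /ab.
  have : `|rad i| <= \sum_(j < m.+1) `|rad j|.
    by rewrite (bigD1 i)//= lerDl sumr_ge0.
  have := ler_norm (rad i); have := h_le i.
  have : `|s - t + n%:~R * t0| <= h i by rewrite ger0_norm// ltW.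
  have := ler_normB (s - t + n%:~R * t0) s.
  have -> : s - t + n%:~R * t0 - s = n%:~R * t0 - t by ring.
  by move: rn; rewrite /r; lra.
apply: lerD; apply: small => n [Dn nDn] E; apply: nDn.
  exact: etrans (esym E) Dn.
exact: etrans E Dn.
Qed.

(** A single nonblank symbol: this puts the vectors that give density into the coded sets. *)
Lemma coded_point_single m : (0 < m)%N ->
  coded_point m (fun n => if n == 0 then m else 0%N) = Y m `[0, h m[%classic.
Proof.
move=> m0; rewrite /coded_point big_ord_recr/= big1 ?add0r; last first.
  move=> [i im] _ /=; have [->|i0] := eqVneq i 0%N; first exact: Y0.
  rewrite (_ : [set _ | _] = set0) ?Y_comb0//.
  apply/seteqP; split=> // k /=; case: ifP => _ E; last by rewrite -E in i0.
  by rewrite E ltnn in im.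
congr (Y m _); apply/seteqP; split=> s /=; rewrite in_itv/=.
  move=> [k /=]; case: eqVneq => [->|_ m0']; last by rewrite -m0' in m0.
  by rewrite mul0r addr0.
by move=> s0; exists 0 => //=; rewrite mul0r addr0.
Qed.

Definition coded_set (m : nat) : set V :=
  [set v | exists2 al, forall n, (al n <= m)%N & v = coded_point m al].

Lemma coded_set_mono m : coded_set m `<=` coded_set m.+1.
Proof.
move=> _ [al alm ->]; exists al; first by move=> n; exact: leqW.
rewrite /coded_point [RHS]big_ord_recr/= (_ : [set _ | _] = set0).
  by rewrite Y_comb0 addr0.
by apply/seteqP; split=> // n /= E; have := alm n; rewrite E ltnn.
Qed.

Lemma coded_set0 : coded_set 0 0.
Proof.
exists (fun=> 0%N) => //; rewrite /coded_point big1// => i _.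
by rewrite ord1 Y0.
Qed.

Lemma coded_set_shift m v : coded_set m v -> coded_set m (T t0 v).
Proof.
move=> [al alm ->]; exists (fun n => al (n + 1%:Z)) => //.
by rewrite -coded_point_shift mul1r.
Qed.

(** [x] is coded by an [l]-periodic sequence that copies the code of each [y r] on the window
    [[a r - w, b r + w]]. The number [l] stays free above its lower bound, so that both the OSP and
    the SgSP can prescribe their own period. *)
Lemma coded_set_specification m (e : R) : 0 < e -> exists2 M : R, t0 < M &
  forall (s : nat) (y : nat -> V) (a b : nat -> R) (l : nat),
    (0 < s)%N ->
    (forall r, (r < s)%N -> coded_set m (y r)) ->
    a 0%N = 0 ->
    (forall r, (r < s)%N -> a r <= b r) ->
    (forall r, (r.+1 < s)%N -> M <= a r.+1 - b r) ->
    M + b s.-1 <= l%:R * t0 ->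
    exists2 x : V, coded_set m x &
      (forall (r : nat) (t : R), (r < s)%N -> a r <= t <= b r ->
         `|T t x - T t (y r)| < e) /\
      T (l%:R * t0) x = x.
Proof.
move=> e0; have [w w0 wP] := coded_point_tracking m e0.
(* [2 * w] separates windows enlarged by [w]; [t0 + 1] makes the separation strict and [M] larger
   than [t0] even if [w = 0]. *)
exists (2 * w + t0 + 1); first by lra.
set M := 2 * w + t0 + 1 => s y a b l s0 yK a0 ab bM lM.
have t0_pos := t0_gt0.
have bb k r : (r + k < s)%N -> b r <= b (r + k)%N.
  elim: k => [|k IH]; first by rewrite addn0.
  rewrite addnS => rk; apply: le_trans (IH (ltnW rk)) _.
  by have := ab _ rk; have := bM _ rk; rewrite /M; lra.
have ba r r' : (r < r')%N -> (r' < s)%N -> b r + M <= a r'.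
  move=> rr' r's; have r'0 : (0 < r')%N by apply: leq_ltn_trans rr'.
  have := bb (r'.-1 - r)%N r; rewrite subnKC; last by rewrite -ltnS prednK.
  move=> /(_ (leq_ltn_trans (leq_pred r') r's)).
  by have := bM r'.-1; rewrite prednK// => /(_ r's); lra.
have age0 r : (r < s)%N -> 0 <= a r.
  case: r => [|r] rs; first by rewrite a0.
  have := ba 0%N r.+1 (ltn0Sn _) rs; have := ab _ s0; rewrite a0 /M; lra.
have ble r : (r < s)%N -> b r <= b s.-1.
  move=> rs; have := bb (s.-1 - r)%N r; rewrite subnKC; last by rewrite -ltnS prednK.
  by apply; rewrite prednK.
have /choice[al alP] : forall r, exists al : int -> nat,
    (r < s)%N -> (forall n, (al n <= m)%N) /\ y r = coded_point m al.
  move=> r; case: (ltnP r s) => [/yK[al alm yE]|_]; last by exists (fun=> 0%N).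
  by exists al.
(* [G n v]: some copy of a window, translated by a multiple of the period [l],
   prescribes the symbol [v] at [n]. *)
pose G (n : int) (v : nat) := exists r (q : int), [/\ (r < s)%N,
  a r - w <= (n - q * l%:Z)%:~R * t0 <= b r + w & v = al r (n - q * l%:Z)].
(* No two windows meet. All windows of one copy lie between [- w] and [b s.-1 + w], so
   [M + b s.-1 <= l * t0] separates different copies; within one copy the gaps do. *)
have Guniq n v v' : G n v -> G n v' -> v = v'.
  move=> [r [q [rs nr ->]]] [r' [q' [r's nr' ->]]].
  have qq' : q = q'.
    have le_q p p' u u' : (u < s)%N -> (u' < s)%N ->
        a u - w <= (n - p * l%:Z)%:~R * t0 <= b u + w ->
        a u' - w <= (n - p' * l%:Z)%:~R * t0 <= b u' + w -> (p <= p')%R.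
      move=> us u's /andP[h1 _] /andP[_ h2]; rewrite leNgt; apply/negP => pp'.
      have l0 : 0 <= l%:R * t0 by rewrite mulr_ge0// ltW.
      have : l%:R * t0 <= (p - p')%:~R * (l%:R * t0).
        by rewrite ler_peMl// ler1z; lia.
      have := age0 _ us; have := ble _ u's; move: h1 h2.
      rewrite !rmorphB/= !rmorphM/= !mulrBl -!mulrA -!pmulrn.
      move: lM; rewrite /M; lra.
    by apply/le_anti/andP; split; [apply: le_q nr nr'|apply: le_q nr' nr].
  subst q'; congr (al _ _).
  have noLt u u' : (u < u')%N -> (u' < s)%N ->
      a u - w <= (n - q * l%:Z)%:~R * t0 <= b u + w ->
      a u' - w <= (n - q * l%:Z)%:~R * t0 <= b u' + w -> False.
    by move=> uu' u's /andP[_ h1] /andP[h2 _]; have := ba _ _ uu' u's; rewrite /M; lra.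
  by have [rr'|rr'|//] := ltngtP r r'; [case: (noLt r r')|case: (noLt r' r)].
(* Outside all windows [xget] returns the blank symbol 0, which keeps [be] bounded by [m]. *)
pose be n := xget 0%N (G n).
have beG n v : G n v -> be n = v.
  by move=> Gn; apply: xget_unique => // v' Gn'; apply: Guniq Gn' Gn.
have be_le n : (be n <= m)%N.
  rewrite /be; case: xgetP => [v _ [r [q [rs _ ->]]]|//].
  exact: (alP r rs).1.
have be_per n : be (n + l%:Z) = be n.
  congr (xget _ _); apply/funext => v; apply/propext.
  split=> -[r [q [rs nr ->]]].
    exists r, (q - 1); have -> : n - (q - 1) * l%:Z = n + l%:Z - q * l%:Z by ring.
    by split.
  exists r, (q + 1); have -> : n + l%:Z - (q + 1) * l%:Z = n - q * l%:Z by ring.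
  by split.
exists (coded_point m be); first by exists be.
split; last first.
  by rewrite coded_point_shift; congr coded_point; exact/funext.
move=> r t rs /andP[art tbr]; have [alm ->] := alP r rs.
apply: wP; first by apply: le_trans (age0 r rs) art.
move=> n nt; apply: beG; exists r, 0; rewrite mul0r subr0; split=> //.
by move: nt; rewrite ler_norml => /andP[]; lra.
Qed.

End shift_coding.

(** * Specification over the real scalars *)

Lemma trajectory_measure_scale (R : realType) (V : normedModType R)
    (T : R -> V -> V) (nu : set R -> V) (c : R) :
  (forall t : R, 0 <= t -> linear (T t)) -> trajectory_measure T nu ->
  trajectory_measure T (fun E => c *: nu E).
Proof.
move=> Tlin [nuU nuT nuV]; split=> [E F mE mF EF|t E t0 mE|e e0].
- by rewrite nuU// scalerDr.
- have T0 : T t 0 = 0.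
    by have := Tlin t t0 (-1) 0 0; rewrite !scaleN1r !addNr.
  by have := Tlin t t0 c (nu E) 0; rewrite T0 !addr0 => ->; rewrite nuT.
- have c0 : 0 < 1 + `|c| by have := normr_ge0 c; lra.
  have [r rP] := nuV (e / (1 + `|c|)) (divr_gt0 e0 c0).
  exists r => E mE Er; have := rP E mE Er; rewrite normrZ ler_pdivlMr// mulrC.
  by apply: le_trans; rewrite ler_wpM2r// lerDr.
Qed.

Lemma real_criterion_specification (R : realType) (V : normedModType R)
    (T S : R -> V -> V) (X0 : set V) (d : nat -> V) :
  (forall v (e : R), 0 < e -> exists n, `|v - d n| < e) ->
  metric_C0_semigroup T ->
  (forall v (e : R), 0 < e -> exists2 x, X0 x & `|v - x| < e) ->
  (forall (t : R) x, 0 < t -> X0 x -> T t (S t x) = x) ->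
  (forall (t r : R) x, 0 < t -> t < r -> X0 x -> T t (S r x) = S (r - t) x) ->
  (forall x, X0 x -> real_pettis_integrable (fun t => T t x)) ->
  (forall x, X0 x -> real_pettis_integrable (fun t => S t x)) ->
  forall t0 : R, 0 < t0 -> exists A : nat -> set V,
    [/\ forall m, A m `<=` A m.+1,
        forall m v, A m v -> A m (T t0 v),
        A 0%N 0,
        forall v (e : R), 0 < e -> exists m, exists2 u, A m u & `|v - u| < e
      & forall m (e : R), 0 < e -> exists2 M : R, t0 < M &
        forall (s : nat) (y : nat -> V) (a b : nat -> R) (l : nat),
        (0 < s)%N ->
        (forall r, (r < s)%N -> A m (y r)) ->
        a 0%N = 0 ->
        (forall r, (r < s)%N -> a r <= b r) ->
        (forall r, (r.+1 < s)%N -> M <= a r.+1 - b r) ->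
        M + b s.-1 <= l%:R * t0 ->
        exists2 x : V, A m x &
          (forall (r : nat) (t : R), (r < s)%N -> a r <= t <= b r ->
             `|T t x - T t (y r)| < e) /\
          T (l%:R * t0) x = x].
Proof.
move=> dd Tsg X0d TSK TSB pT pS t0 t0_gt0; have [[Tlin _] _ _ _] := Tsg.
pose ix n : nat * nat := odflt (0, 0)%N (unpickle n).
(* [ix n] decodes [n] into the index of a point of the dense sequence and a precision [c]. One [c]
   is spent on approximating that point by some [x] in [X0], the other on approximating [x] by an
   average. *)
have /choice[p pP] : forall n, exists p : (set R -> V) * R,
    [/\ trajectory_measure T p.1, 0 < p.2 <= t0 &
        `|d (ix n).1 - p.1 `[0, p.2[%classic| < 2 * (ix n).2.+1%:R^-1].
  move=> n; set c := (ix n).2.+1%:R^-1.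
  have c0 : 0 < c :> R by rewrite invr_gt0.
  have [x X0x dx] := X0d (d (ix n).1) c c0.
  have [nu nutraj nuP] := criterion_trajectory Tsg (fun t t0 => TSK t x t0 X0x)
    (fun t r t0 tr => TSB t r x t0 tr X0x) (pT x X0x) (pS x X0x) dd.
  have [h h0 hx] := nuP c t0 c0 t0_gt0.
  exists (fun E => h^-1 *: nu E, h); split=> //=.
    exact: trajectory_measure_scale.
  have := ler_normB (d (ix n).1 - x) (h^-1 *: nu `[0, h[%classic - x).
  by rewrite opprB addrA subrK; lra.
(* Index 0 is reserved for the zero measure, the blank symbol. *)
pose Y n := if n is n.+1 then (p n).1 else fun=> 0.
pose h n := if n is n.+1 then (p n).2 else t0.
have Y0 E : Y 0%N E = 0 by [].
have h_le n : h n <= t0 by case: n => //= n; case: (pP n) => _ /andP[].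
have Ytraj n : trajectory_measure T (Y n).
  case: n => [|n]; last by case: (pP n).
  split=> /= [*|t E t_ge0 _|e e0]; first by rewrite addr0.
    by have := Tlin t t_ge0 (-1) 0 0; rewrite !scaleN1r !addNr.
  by exists 0 => *; rewrite normr0 ltW.
exists (coded_set t0 Y h); split.
- by move=> m; exact: (coded_set_mono t0_gt0 h_le Ytraj).
- by move=> m v; exact: (coded_set_shift Tlin t0_gt0 Ytraj).
- exact: coded_set0.
(* [e / 4] is spent between [v] and [d i], and twice [e / 4] between [d i] and the coded vector. *)
- move=> v e e0; have e4 : 0 < e / 4 by lra.
  have [i vi] := dd v _ e4.
  pose q := Num.truncn (e / 4)^-1.
  have qe : q.+1%:R^-1 < e / 4.
    by rewrite invf_plt ?posrE//; exact: truncnS_gt.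
  pose n := pickle (i, q).
  have ixn : ix n = (i, q) by rewrite /ix pickleK.
  exists n.+1, (Y n.+1 `[0, h n.+1[%classic).
    exists (fun k : int => if k == 0 then n.+1 else 0%N).
      by move=> k; case: ifP.
    by rewrite (coded_point_single t0_gt0 h_le Ytraj Y0).
  have [_ _] := pP n; rewrite ixn /=.
  have := ler_normD (v - d i) (d i - (p n).1 `[0, (p n).2[%classic).
  by rewrite addrA subrK; move: (_^-1) qe => c qe; lra.
- by move=> m e; exact: (coded_set_specification Tlin t0_gt0 h_le Ytraj).
Qed.

(** * Restriction of scalars to the reals *)

Section realification.
Context (R : realType) (k : scalar_kind).

Definition real_scalar : R -> scalar_field R k :=
  match k return R -> scalar_field R k with
  | RealScalars => id
  | ComplexScalars => fun r => r%:C%C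
  end.

Definition scalar_re : scalar_field R k -> R :=
  match k return scalar_field R k -> R with
  | RealScalars => id
  | ComplexScalars => @complex.Re R
  end.

Lemma real_scalarD a b : real_scalar (a + b) = real_scalar a + real_scalar b.
Proof. by rewrite /real_scalar; case: k => //=; rewrite rmorphD. Qed.

Lemma real_scalarM a b : real_scalar (a * b) = real_scalar a * real_scalar b.
Proof. by rewrite /real_scalar; case: k => //=; rewrite rmorphM. Qed.

Lemma real_scalar1 : real_scalar 1 = 1.
Proof. by rewrite /real_scalar; case: k. Qed.

Lemma real_scalar_norm a : `|real_scalar a| = real_scalar `|a|.
Proof.
rewrite /real_scalar; case: k => //=.
by rewrite normc_def/= expr0n addr0 sqrtr_sqr.
Qed.

Lemma real_scalarK a : scalar_re (real_scalar a) = a.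
Proof. by rewrite /scalar_re /real_scalar; case: k. Qed.

Lemma scalar_re0 : scalar_re 0 = 0.
Proof. by rewrite /scalar_re; case: k. Qed.

Lemma scalar_reD z1 z2 : scalar_re (z1 + z2) = scalar_re z1 + scalar_re z2.
Proof. by move: z1 z2; rewrite /scalar_re; case: k => //= -[? ?] [? ?]. Qed.

Lemma scalar_reMl a z : scalar_re (real_scalar a * z) = a * scalar_re z.
Proof.
move: z; rewrite /scalar_re /real_scalar; case: k => //= -[? ?] /=.
by rewrite mul0r subr0.
Qed.

Lemma scalar_re_le z1 z2 : z1 <= z2 -> scalar_re z1 <= scalar_re z2.
Proof.
by move: z1 z2; rewrite /scalar_re; case: k => //= -[? ?] [? ?]; rewrite lecE => /andP[].
Qed.

Lemma scalar_re_lt z1 z2 : z1 < z2 -> scalar_re z1 < scalar_re z2.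
Proof.
by move: z1 z2; rewrite /scalar_re; case: k => //= -[? ?] [? ?]; rewrite ltcE => /andP[].
Qed.

Lemma real_scalar_lt a b : (real_scalar a < real_scalar b) = (a < b).
Proof. by rewrite /real_scalar; case: k => //=; rewrite ltcR. Qed.

Lemma scalar_reK z : 0 <= z -> real_scalar (scalar_re z) = z.
Proof.
move: z; rewrite /scalar_re /real_scalar; case: k => //= -[? ?].
by rewrite lecE/= => /andP[/eqP -> _].
Qed.

(* [X] with its scalars restricted to the reals and its norm taken in [R]. *)
Definition realified (X : normedModType (scalar_field R k)) : Type := X.

End realification.

Section realified_module.
Context (R : realType) (k : scalar_kind) (X : normedModType (scalar_field R k)).

HB.instance Definition _ := GRing.Zmodule.copy (realified X) X.

Definition real_scale (a : R) (v : realified X) : realified X :=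
  (real_scalar k a *: (v : X)).

Let real_scaleA a b v : real_scale a (real_scale b v) = real_scale (a * b) v.
Proof. by rewrite /real_scale scalerA real_scalarM. Qed.

Let real_scale1 : left_id 1 real_scale.
Proof. by move=> v; rewrite /real_scale real_scalar1 scale1r. Qed.

Let real_scaleDr : right_distributive real_scale +%R.
Proof. by move=> a u v; rewrite /real_scale -scalerDr. Qed.

Let real_scaleDl v : {morph real_scale^~ v : a b / a + b}.
Proof. by move=> a b; rewrite /real_scale real_scalarD scalerDl. Qed.

HB.instance Definition _ := GRing.Zmodule_isLmodule.Build R (realified X)
  real_scaleA real_scale1 real_scaleDr real_scaleDl.

Definition real_norm (v : realified X) : R := scalar_re (`|v : X| : scalar_field R k).

Let real_normD u v : real_norm (u + v) <= real_norm u + real_norm v.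
Proof. by rewrite /real_norm -scalar_reD; apply: scalar_re_le; exact: ler_normD. Qed.

Let real_normZ a v : real_norm (a *: v) = `|a| * real_norm v.
Proof. by rewrite /real_norm normrZ real_scalar_norm scalar_reMl. Qed.

Let real_norm0_eq0 v : real_norm v = 0 -> v = 0.
Proof.
move=> v0; apply: (@normr0_eq0 _ X).
rewrite -(@scalar_reK R k `|v : X|)// [scalar_re _]v0 -(@scalar_re0 R k).
by rewrite scalar_reK// lexx.
Qed.

HB.instance Definition _ := Lmodule_isNormed.Build R (realified X)
  real_normD real_normZ real_norm0_eq0.

Lemma realified_norm (v : X) :
  `|v| = real_scalar k `|v : realified X| :> scalar_field R k.
Proof. by rewrite scalar_reK. Qed.

End realified_module.

Section realified_transfer.
Context (R : realType) (k : scalar_kind) (X : normedModType (scalar_field R k)).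
Local Notation V := (realified X).

Lemma realified_norm_lt (v : X) (e : scalar_field R k) : 0 < e ->
  (`|v| < e) = (`|v : V| < scalar_re e).
Proof.
by move=> e0; rewrite realified_norm -{1}(scalar_reK (ltW e0)) real_scalar_lt.
Qed.

Lemma realified_dense (D : set X) : dense D ->
  forall (v : V) (e : R), 0 < e -> exists2 x : V, D x & `|v - x| < e.
Proof.
move=> DD v e e0.
have e0' : 0 < real_scalar k e.
  by rewrite -(scalar_reK (lexx 0)) scalar_re0 real_scalar_lt.
have [|x [xv Dx]] := DD (ball (v : X) (real_scalar k e))^° _ (@open_interior _ _).
  by exists (v : X); apply: nbhsx_ballx.
exists x => //; move: xv => /interior_subset.
by rewrite -ball_normE/= realified_norm_lt// real_scalarK.
Qed.

Lemma realified_separable : separable_space X ->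
  exists d : nat -> V, forall (v : V) (e : R), 0 < e -> exists n, `|v - d n| < e.
Proof.
move=> [D /countable_injP[f finj] DD].
exists (fun n => xget 0 [set x : X | D x /\ f x = n]) => v e e0.
have [x Dx vx] := realified_dense DD v e0; exists (f x).
suff -> : xget 0 [set y : X | D y /\ f y = f x] = x by [].
apply: xget_unique => //= y [Dy fxy].
by apply: finj => //; exact/mem_set.
Qed.

Lemma realified_C0 (T : R -> X -> X) : C0_semigroup T ->
  @metric_C0_semigroup R V T.
Proof.
move=> [Tbl T0 TD Tc]; split=> //; first split.
- by move=> t t0 a u v; exact: (Tbl t t0).1.
- move=> t t0; have [_ [M TM]] := Tbl t t0; exists (scalar_re M) => v.
  have := scalar_re_le (TM v).
  rewrite [in X in X -> _]realified_norm real_scalarK [`|v : X|]realified_norm.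
  by rewrite mulrC scalar_reMl mulrC.
move=> v s e s0 e0.
have e0' : 0 < real_scalar k e.
  by rewrite -(scalar_reK (lexx 0)) scalar_re0 real_scalar_lt.
have := Tc v s s0 => /cvgrPdist_lt/(_ _ e0')/nbhs_ballP[r /= r0 rP].
exists r => // t t0 ts.
have := rP t; rewrite /ball/= distrC => /(_ ts).
rewrite in_itv/= andbT => /(_ t0).
by rewrite realified_norm_lt// real_scalarK (@distrC _ V).
Qed.

End realified_transfer.

(** Over the complex scalars every real functional is the real part of a complex-linear one, so its
    integrability and its integrals are obtained by taking real parts. *)
Lemma realified_pettis (R : realType) (k : scalar_kind)
    (X : normedModType (scalar_field R k)) (f : R -> X) :
  pettis_integrable f -> @real_pettis_integrable R (realified X) f.
Proof.
case: k X f => X f [intf fE].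
  have blin psi : @dual_ball R (realified X) psi ->
      bounded_linear (psi : X -> (scalar_field R RealScalars)^o).
    move=> [lpsi psi1]; split; first exact: lpsi.
    by exists 1 => x; rewrite mul1r; exact: psi1.
  split=> [psi /blin/intf //|E mE E0].
  by have [xE xEP] := fE E mE E0; exists xE => psi /blin/xEP.
(* The complex-linear functional with real part [psi]. *)
pose phi (psi : realified X -> R) (x : X) : (scalar_field R ComplexScalars)^o :=
  (Complex (psi x) (- psi ('i%C *: x))).
have blin psi : @dual_ball R (realified X) psi -> bounded_linear (phi psi).
  move=> [lpsi psi1].
  have psi0 : psi 0 = 0.
    by have := lpsi (-1) 0 0; rewrite scaleN1r addNr mulN1r addNr.
  have psiZ (b : R) (w : X) : psi (real_scalar ComplexScalars b *: w) = b * psi w.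
    by have := lpsi b w 0; rewrite psi0 !addr0.
  have psiD (u w : X) : psi (u + w) = psi u + psi w.
    by have := lpsi 1 u w; rewrite scale1r mul1r.
  split=> [[b c] u v|].
    have aE : Complex b c = (real_scalar ComplexScalars b : R[i]) +
        real_scalar ComplexScalars c * 'i%C.
      by apply/eqP; rewrite eq_complex/=; apply/andP; split; apply/eqP; ring.
    have ii : 'i%C * 'i%C = real_scalar ComplexScalars (-1) :> R[i].
      by rewrite /= -expr2 sqr_i rmorphN rmorph1.
    have psia w : psi (Complex b c *: w : X) = b * psi w + c * psi ('i%C *: w : X).
      by rewrite aE scalerDl psiD psiZ -scalerA psiZ.
    rewrite /phi scalerDr !psiD scalerA [(_ * Complex b c)%R]mulrC -scalerA !psia.
    rewrite scalerA ii psiZ.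
    apply/eqP; rewrite eq_complex/=; apply/andP; split; apply/eqP; ring.
  (* The modulus is at most the sum of the absolute values of the real and imaginary parts, each of
     them at most the norm of [x]. *)
  exists (real_scalar ComplexScalars 2) => x.
  have psii : `|psi ('i%C *: x : X)| <= `|x : realified X|.
    apply: le_trans (psi1 _) _.
    rewrite -[leLHS](real_scalarK ComplexScalars) -realified_norm normrZ.
    by rewrite normc_def/= expr0n expr1n add0r sqrtr1 mul1r.
  have h := psi1 x.
  rewrite [`|x|]realified_norm -real_scalarM.
  rewrite normc_def /= lecR.
  apply: (@le_trans _ _ (`|psi x| + `|psi ('i%C *: x : X)|)); last lra.
  rewrite -[leRHS]ger0_norm ?addr_ge0// -sqrtr_sqr ler_wsqrtr//.
  rewrite sqrrN sqrrD !real_normK ?num_real//.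
  have : 0 <= `|psi x| * `|psi ('i%C *: x : X)| by rewrite mulr_ge0.
  by rewrite -mulr_natr; lra.
split=> [psi /blin/intf[] //|E mE E0].
by have [xE xEP] := fE E mE E0; exists xE => psi /blin/xEP/(congr1 (@complex.Re R)).
Qed.

(** * The two specification properties *)

Lemma C0_semigroup_iter (R : realType) (K : numFieldType) (X : normedModType K)
    (T : R -> X -> X) (t : R) (x : X) (n : nat) :
  C0_semigroup T -> 0 <= t -> iter n (T t) x = T (n%:R * t) x.
Proof.
move=> [_ T0 TD _] t0; elim: n => [|n IH] /=; first by rewrite mul0r T0.
by rewrite IH TD ?mulr_ge0// -natr1 mulrDl mul1r addrC.
Qed.

(** The sets found over the reals carry over unchanged; only norms and thresholds are translated
    back to the original scalars. *)
Lemma criterion_specification (R : realType) (k : scalar_kind)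
    (X : normedModType (scalar_field R k)) (T : R -> X -> X) (t0 : R) :
  separable_space X -> C0_semigroup T -> frequent_hypercyclicity_criterion T ->
  0 < t0 -> exists A : nat -> set X,
    [/\ forall m, A m `<=` A m.+1,
        forall m, T t0 @` A m `<=` A m,
        A 0%N 0,
        closure (\bigcup_m A m) = setT
      & forall m (e : scalar_field R k), 0 < e -> exists2 M : R, t0 < M &
        forall (s : nat) (y : nat -> X) (a b : nat -> R) (l : nat),
        (0 < s)%N ->
        (forall r, (r < s)%N -> A m (y r)) ->
        a 0%N = 0 ->
        (forall r, (r < s)%N -> a r <= b r) ->
        (forall r, (r.+1 < s)%N -> M <= a r.+1 - b r) ->
        M + b s.-1 <= l%:R * t0 ->
        exists2 x : X, A m x &
          (forall (r : nat) (t : R), (r < s)%N -> a r <= t <= b r ->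
             `|T t x - T t (y r)| < e) /\
          T (l%:R * t0) x = x].
Proof.
move=> /realified_separable[d dd] /realified_C0 Tsg
  [X0 [S [[X0d _] TSK TSB pT pS]]] t0_gt0.
have [A [Amono Ainv A0 Adense Aspec]] := @real_criterion_specification R (realified X)
  T S X0 d dd Tsg (realified_dense X0d) TSK TSB
  (fun x X0x => realified_pettis (pT x X0x)) (fun x X0x => realified_pettis (pS x X0x))
  t0 t0_gt0.
exists A; split=> //.
- by move=> m _ [v Av <-]; exact: Ainv.
- apply/seteqP; split=> // v _ B /nbhs_ballP[e /= e0 eB].
  have e0' : 0 < scalar_re e by rewrite -(@scalar_re0 R k); exact: scalar_re_lt.
  have [m [u Au vu]] := Adense v _ e0'.
  exists u; split; first by exists m.
  by apply: eB; rewrite -ball_normE/= realified_norm_lt.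
move=> m e e0.
have e0' : 0 < scalar_re e by rewrite -(@scalar_re0 R k); exact: scalar_re_lt.
have [M tM MP] := Aspec m _ e0'; exists M => // s y a b l s0 yA a0 ab bM lM.
have [x Ax [xy Tx]] := MP s y a b l s0 yA a0 ab bM lM.
exists x => //; split=> // r t rs art.
by rewrite realified_norm_lt//; exact: xy.
Qed.

Theorem proposition11 (R : realType) (k : scalar_kind)
    (X : completeNormedModType (scalar_field R k)) (T : R -> X -> X) :
  separable_space X ->
  C0_semigroup T ->
  frequent_hypercyclicity_criterion T ->
  (forall t : R, 0 < t -> OSP (T t)) /\ SgSP T.
Proof.
move=> sepX Tsg fhc; split.
  move=> t t0; have [A [Amono Ainv A0 Adense Aspec]] :=
    criterion_specification sepX Tsg fhc t0.
  exists A; split=> // m e e0; have [M tM MP] := Aspec m e e0.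
  have iterE n x : iter n (T t) x = T (n%:R * t) x.
    by apply: C0_semigroup_iter => //; exact: ltW.
  (* [N] steps of length [t] last at least [M], so gaps of [N] iterations become time gaps of [M];
     the successor also makes [N] positive. *)
  pose N := (Num.truncn (M / t)).+1.
  have MN : M <= N%:R * t by rewrite -ler_pdivrMr// ltW// truncnS_gt.
  exists N => // s y j l s2 yA j0 jl gap.
  have [||||||x Ax [xy xper]] := MP s y (fun r => (j r)%:R * t)
    (fun r => (l r)%:R * t) (N + l s.-1)%N => //.
  - exact: ltnW.
  - by rewrite j0 mul0r.
  - by move=> r rs; rewrite ler_pM2r// ler_nat jl.
  - move=> r rs; have [lj Nlj] := gap r rs.
    apply: le_trans MN _; rewrite -mulrBl -natrB; last exact: ltnW.
    by rewrite ler_pM2r// ler_nat.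
  - by rewrite natrD mulrDl lerD2r.
  exists x => //; split; last by rewrite iterE.
  move=> r i rs /andP[ji il]; rewrite !iterE; apply: xy => //.
  by rewrite !ler_pM2r// !ler_nat ji.
(* The SgSP asks for some [t0]; with [t0 = 1] its multiples are the natural numbers. *)
have [A [Amono Ainv A0 Adense Aspec]] := criterion_specification sepX Tsg fhc ltr01.
exists A, 1; split=> // m; split=> // e e0; have [M M1 MP] := Aspec m e e0.
exists M => // s y a b s2 yA a0 ab gap.
have s0 : (0 < s)%N := ltnW s2.
have age0 r : (r < s)%N -> 0 <= a r.
  elim: r => [|r IH] rs; first by rewrite a0.
  have := IH (ltnW rs); have := ab _ (ltnW rs); have := (gap r rs).1; lra.
have bge0 : 0 <= b s.-1.
  have ss : (s.-1 < s)%N by rewrite prednK.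
  by apply: le_trans (ab _ ss); exact: age0.
pose z := M + b s.-1.
have z0 : 0 <= z by rewrite /z; lra.
(* [l] is the least natural number above or equal to [z]: the truncation of [z] if [z] is itself
   one, and its successor otherwise. *)
have [l lz] : exists l : nat, z <= l%:R * 1 < z + 1.
  have /andP[h1 h2] := truncn_itv z0.
  have [h|h] := leP z (Num.truncn z)%:R.
    by exists (Num.truncn z); rewrite mulr1 h; lra.
  by exists (Num.truncn z).+1; rewrite mulr1 (ltW h2) -natr1; lra.
have [||||||x Ax [xy xper]] := MP s y a b l => //.
- by move=> r rs; exact: (gap r rs).2.
- by case/andP: lz.
by exists x => //; split=> //; exists l.
Qed.
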